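(* Let $1\le p<\infty$, $n\in\mathbb N$, $F\in L^p$, and $f=F^{(n)}\in L^{(n),p}$. Let $\Phi_y(x)=\frac{y}{\pi}(x^2+y^2)^{-1}$ and $U_y(x)=\Phi_y\ast F(x)=\frac{y}{\pi}\int_{-\infty}^\infty F(\xi)[(x-\xi)^2+y^2]^{-1}\,d\xi$ for $(x,y)\in\Pi^+=\{(x,y): y>0\}$. Then: (a) for each $(x,y)\in\Pi^+$, the Poisson integral $u_y(x)=\Phi_y\ast f(x):=(-1)^n\int_{-\infty}^\infty F(\xi)\,\frac{\partial^n}{\partial\xi^n}\Phi_y(\xi-x)\,d\xi$ is well defined (as a Lebesgue integral) and equals $\frac{\partial^n}{\partial x^n}U_y(x)$; (b) $(x,y)\mapsto u_y(x)$ is harmonic in $\Pi^+$; (c) for each $y>0$, $u_y\in L^{(n),p}$ (with primitive $U_y$) and $\|u_y\|^{(n)}_p\le\|f\|^{(n)}_p$; (d) $\|u_y-f\|^{(n)}_p\to0$ as $y\to0^+$.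
   Context: $D^n$ or $F^{(n)}$ denotes the $n$th distributional derivative on $\mathcal S'$. For $1\le p<\infty$, $L^{(n),p}=\{f\in\mathcal S' : f=D^nF \text{ for some } F\in L^p(\mathbb R)\}$; such $F$ is unique (the primitive), linear operations are defined through primitives, and $\|f\|^{(n)}_p:=\|F\|_p$. *)

(* Defs.v *)
From HB Require Import structures.
From mathcomp Require Import all_boot all_order all_algebra.
From mathcomp Require Import all_classical all_reals all_analysis.
Set Implicit Arguments. Unset Strict Implicit. Unset Printing Implicit Defensive.
Import Order.TTheory GRing.Theory Num.Theory.
Import numFieldNormedType.Exports.
Local Open Scope classical_set_scope.
Local Open Scope ring_scope.

Section Defs.
Variable R : realType.

Local Notation mu := (@lebesgue_measure R).

(* F is in L^p(R) (Borel-measurable representative), 1 <= p < oo *)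
Definition inLp (p : R) (F : R -> R) : Prop :=
  measurable_fun setT F /\
  (\int[mu]_x ((`|F x| `^ p)%:E) < +oo)%E.

Definition Lpnorm (p : R) (F : R -> R) : \bar R :=
  Lnorm mu p%:E (EFin \o F).

Definition schwartz (phi : R -> R) : Prop :=
  (forall j x, derivable (derive1n j phi) x 1) /\
  (forall j k : nat, exists M : R, forall x, `|x| ^+ k * `|derive1n j phi x| <= M).

(* "u = D^n G in S'": the function u defines a tempered distribution
   (u * phi integrable for every Schwartz phi) equal to the n-th
   distributional derivative of G. *)
Definition is_nth_distr_deriv (n : nat) (u G : R -> R) : Prop :=
  forall phi, schwartz phi ->
    mu.-integrable setT (EFin \o (fun x => u x * phi x)) /\
    Rintegral mu setT (fun x => u x * phi x) =
      (-1) ^+ n * Rintegral mu setT (fun x => G x * derive1n n phi x).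

Definition poisson (y x : R) : R := y / (pi * (x ^+ 2 + y ^+ 2)).

Definition poissonU (F : R -> R) (y x : R) : R :=
  Rintegral mu setT (fun xi => F xi * poisson y (x - xi)).

Definition poisson_integrand (n : nat) (F : R -> R) (y x : R) : R -> R :=
  fun xi => F xi * derive1n n (fun t => poisson y (t - x)) xi.

Definition poissonu (n : nat) (F : R -> R) (y x : R) : R :=
  (-1) ^+ n * Rintegral mu setT (poisson_integrand n F y x).

Definition pdx (w : R * R -> R) : R * R -> R :=
  fun z => derive1 (fun t => w (t, z.2)) z.1.
Definition pdy (w : R * R -> R) : R * R -> R :=
  fun z => derive1 (fun t => w (z.1, t)) z.2.
Definition has_pdx (w : R * R -> R) (z : R * R) : Prop :=
  derivable (fun t => w (t, z.2)) z.1 1.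
Definition has_pdy (w : R * R -> R) (z : R * R) : Prop :=
  derivable (fun t => w (z.1, t)) z.2 1.

Definition C2_on (D : set (R * R)) (w : R * R -> R) : Prop :=
  forall z, D z ->
    (has_pdx w z /\ has_pdy w z /\
     has_pdx (pdx w) z /\ has_pdy (pdx w) z /\
     has_pdx (pdy w) z /\ has_pdy (pdy w) z) /\
    ({for z, continuous w} /\
     {for z, continuous (pdx w)} /\ {for z, continuous (pdy w)} /\
     {for z, continuous (pdx (pdx w))} /\ {for z, continuous (pdy (pdx w))} /\
     {for z, continuous (pdx (pdy w))} /\ {for z, continuous (pdy (pdy w))}).

Definition harmonic_on (D : set (R * R)) (w : R * R -> R) : Prop :=
  open D /\ C2_on D w /\
  forall z, D z -> pdx (pdx w) z + pdy (pdy w) z = 0.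

Definition upper_half_plane : set (R * R) := [set z | 0 < z.2].

End Defs.

(* Main.v *)
(** Write [(t + i y)^-m] for the complex powers.  The Poisson kernel is [- 1/pi]
    times the imaginary part of [(t + i y)^-1], and differentiation in [t] or [y]
    permutes, up to constants, the real and imaginary parts of these powers.  All
    of them with [m > 0], except [Re (t + i y)^-1], are dominated by [C / (1 + t^2)], locally
    uniformly in [y > 0], and [|F(xi)| / (1 + xi^2)] is integrable for [F] in
    [L^p]; differentiating under the integral sign gives (a), and (b) follows
    since the two second derivatives of [(t + i y)^-m] cancel.

    Jensen's inequality for the probability density [Phi_y] and Tonelli's theorem
    give, for [k = 0, 1],
      [int |U_y - k F|^p <= int Phi_y(s) (int |F(x + s) - k F(x)|^p dx) ds].
    For [k = 0] this is the contraction in (c); for [k = 1] it yields (d), because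
    translation is continuous in [L^p] and the mass of [Phi_y] concentrates at
    [0].  The derivatives of [U_y] grow at most like [1 + x^2], so integrating by
    parts against Schwartz functions leaves no boundary terms, and [u_y] is the
    [n]-th distributional derivative of [U_y]. *)
Require Import Defs.
From HB Require Import structures.
From mathcomp Require Import all_boot all_order all_algebra.
From mathcomp Require Import all_classical all_reals all_analysis.
From mathcomp Require Import measurable_realfun ring lra.
Set Implicit Arguments. Unset Strict Implicit. Unset Printing Implicit Defensive.
Import Order.TTheory GRing.Theory Num.Theory.
Import numFieldNormedType.Exports.
Local Open Scope classical_set_scope.
Local Open Scope ring_scope.

(** * Translation invariance of Lebesgue measure and integral *)

Section translation.
Context {R : realType}.
Local Notation mu := (@lebesgue_measure R).

(** Lebesgue measure is determined by its values on half-open intervals, and the preimage of such an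
    interval under a translation is one of the same length. *)
Lemma lebesgue_measure_translation (s : R) (A : set R) : measurable A ->
  pushforward mu ((fun x => x + s) : _ -> measurableTypeR R) A = mu A.
Proof.
have ms : measurable_fun setT ((fun x : R => x + s) : R -> measurableTypeR R).
  exact: measurable_funD.
pose ms' := isMeasurableFun.Build _ _ _ _ _ ms.
pose f : {mfun R >-> measurableTypeR R} :=
  HB.pack ((fun x : R => x + s) : R -> measurableTypeR R) ms'.
move=> mA; apply/esym.
apply: (@lebesgue_measure_unique R (pushforward mu f)) => //= _ [[a b]] _ <-.
rewrite /pushforward/= (_ : _ @^-1` _ = `]a - s, b - s]%classic).
  rewrite !lebesgue_measure_itv/= !lte_fin ltrD2r; case: ifPn => // _.
  by rewrite -!EFinD; congr EFin; ring.
by apply/seteqP; split => x /=; rewrite !in_itv/= ltrBlDr lerBrDr.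
Qed.

Lemma ge0_integral_translation (s : R) (f : R -> \bar R) :
  measurable_fun setT f -> (forall x, 0 <= f x)%E ->
  (\int[mu]_x f (x + s)%R = \int[mu]_x f x)%E.
Proof.
move=> mf f0.
have ms : measurable_fun setT ((fun x : R => x + s) : R -> measurableTypeR R).
  exact: measurable_funD.
pose sh := (fun x : R => x + s) : _ -> measurableTypeR R.
rewrite -[LHS]/(\int[mu]_x (f \o sh) x)%E -(preimage_setT sh).
rewrite -ge0_integral_pushforward//=.
by apply: eq_measure_integral => A mA _; exact: lebesgue_measure_translation.
Qed.

End translation.

(** * Jensen's inequality for the power function *)

Section jensen.
Context {R : realType}.

(** The tangent line of the convex function $t^p$ at [a], rearranged so that every term is
    nonnegative. It is Young's inequality for the exponents $p$ and $p/(p-1)$; the case $p=1$ is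
    done apart. *)
Lemma powR_tangent (p a g : R) : 1 <= p -> 0 <= a -> 0 <= g ->
  p * (a `^ (p - 1) * g) <= g `^ p + (p - 1) * a `^ p.
Proof.
move=> p1 a0 g0; move: p1; rewrite le_eqVlt => /predU1P[<-|p1].
  by rewrite subrr powRr0 !mul1r mul0r addr0 powRr1.
have p0 : 0 < p by lra.
have q0 : 0 < p / (p - 1) by rewrite divr_gt0//; lra.
have pq : p^-1 + (p / (p - 1))^-1 = 1 by field; rewrite !gt_eqF//; lra.
have := conjugate_powR g0 (powR_ge0 a (p - 1)) p0 q0 pq.
rewrite -powRrM (_ : (p - 1) * (p / (p - 1)) = p); last first.
  by field; rewrite gt_eqF//; lra.
rewrite -(ler_pM2l p0) mulrDr => H.
apply: le_trans (le_trans _ H) _; first by rewrite (mulrC g).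
rewrite le_eqVlt; apply/orP; left; apply/eqP; field.
by rewrite !gt_eqF//; lra.
Qed.

Context d (T : measurableType d) (mu : {measure set T -> \bar R}).

(** The tangent inequality at the mean [a] is integrated against the density [w], giving $p a^p \le
    \int w g^p + (p-1)a^p$. *)
Lemma powR_jensen (p : R) (w g : T -> R) : 1 <= p ->
  measurable_fun setT w -> measurable_fun setT g ->
  (forall x, 0 <= w x) -> (forall x, 0 <= g x) ->
  (\int[mu]_x (w x)%:E = 1)%E ->
  mu.-integrable setT (fun x => (w x * g x)%:E) ->
  (((\int[mu]_x (w x * g x)) `^ p)%:E <= \int[mu]_x (w x * g x `^ p)%:E)%E.
Proof.
move=> p1 mw mg w0 g0 w1 wg.
set a := Rintegral _ _ _.
have a0 : 0 <= a by apply: Rintegral_ge0 => x _; exact: mulr_ge0.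
have aE : (\int[mu]_x (w x * g x)%:E = a%:E)%E.
  by rewrite /a /Rintegral fineK//; exact: integrable_fin_num.
have mgp : measurable_fun setT (fun x => g x `^ p).
  exact: (measurableT_comp (measurable_powR p) mg).
have ap0 := powR_ge0 a (p - 1); have ap := powR_ge0 a p.
have wgp x : 0 <= w x * g x `^ p by rewrite mulr_ge0// powR_ge0.
have : (\int[mu]_x ((p * a `^ (p - 1))%:E * (w x * g x)%:E) <=
    \int[mu]_x ((w x * g x `^ p)%:E + ((p - 1) * a `^ p)%:E * (w x)%:E))%E.
  apply: ge0_le_integral => //.
  - move=> x _; rewrite -EFinM lee_fin mulr_ge0//; last exact: mulr_ge0.
    by rewrite mulr_ge0//; lra.
  - by apply: measurable_funeM; apply/measurable_EFinP; exact: measurable_funM.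
  - apply: emeasurable_funD; last exact/measurable_funeM/measurable_EFinP.
    by apply/measurable_EFinP; exact: measurable_funM.
  - move=> x _; rewrite -!EFinM -EFinD lee_fin.
    have := ler_wpM2l (w0 x) (powR_tangent p1 a0 (g0 x)).
    by rewrite mulrDr; move: (w x) (g x) (_ `^ _) (_ `^ _) (_ `^ _) => *; lra.
rewrite ge0_integralZl_EFin//; last 3 first.
- by move=> x _; rewrite lee_fin mulr_ge0.
- by apply/measurable_EFinP; exact: measurable_funM.
- by rewrite mulr_ge0//; lra.
rewrite ge0_integralD//; last 4 first.
- by move=> x _; rewrite lee_fin.
- by apply/measurable_EFinP; exact: measurable_funM.
- by move=> x _; rewrite -EFinM lee_fin !mulr_ge0//; lra.
- exact/measurable_funeM/measurable_EFinP.
rewrite ge0_integralZl_EFin//; last 3 first.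
- by move=> x _; rewrite lee_fin.
- exact/measurable_EFinP.
- by rewrite mulr_ge0//; lra.
rewrite aE w1 mule1 -EFinM.
have -> : p * a `^ (p - 1) * a = p * a `^ p.
  by rewrite -mulrA; congr (_ * _); rewrite mulrC mulr_powRB1//; lra.
have : (0 <= \int[mu]_x (w x * g x `^ p)%:E)%E.
  by apply: integral_ge0 => x _; rewrite lee_fin.
(* Nothing makes the right-hand integral finite; if it is infinite the claim is trivial, otherwise
   $(p-1)a^p$ cancels. *)
case: (\int[mu]_x _)%E => [r| |]//= _; last by move=> _; rewrite leey.
by rewrite -EFinD !lee_fin => H; lra.
Qed.

End jensen.

(** * The Poisson kernel as a probability density *)

Section poisson_kernel.
Context {R : realType}.
Local Notation mu := (@lebesgue_measure R).
Implicit Types (y t : R).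

Lemma sqrD_sqr_gt0 y t : 0 < y -> 0 < t ^+ 2 + y ^+ 2.
Proof. by move=> y0; rewrite ltr_wpDl ?sqr_ge0// exprn_gt0. Qed.

Lemma oneD_sqr_gt0 t : 0 < 1 + t ^+ 2.
Proof. by rewrite ltr_wpDr ?sqr_ge0. Qed.

Lemma poisson_gt0 y t : 0 < y -> 0 < poisson y t.
Proof. by move=> y0; rewrite divr_gt0// mulr_gt0 ?pi_gt0// sqrD_sqr_gt0. Qed.

Lemma poissonN y t : poisson y (- t) = poisson y t.
Proof. by rewrite /poisson sqrrN. Qed.

Lemma continuous_poisson y : 0 < y -> continuous (poisson y).
Proof.
move=> y0 t; apply: cvgM; first exact: cvg_cst.
apply: cvgV; first by rewrite mulf_neq0// gt_eqF ?pi_gt0 ?sqrD_sqr_gt0.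
apply: cvgM; first exact: cvg_cst.
apply: cvgD; last exact: cvg_cst.
by apply: cvgM; exact: cvg_id.
Qed.

Lemma is_derive_poisson_primitive y t : 0 < y ->
  is_derive t 1 (fun u : R => pi^-1 * atan (y^-1 * u)) (poisson y t).
Proof.
move=> y0; pose f (u : R) := y^-1 * u.
have df : is_derive t 1 f (y^-1 * 1) by exact: is_deriveZ.
have := @is_derive1_comp R (@atan R) f t _ _ (is_derive1_atan _) df.
move=> da.
have := @is_deriveZ R R R (@atan R \o f) pi^-1 t 1 _ da.
move=> /is_derive_eq; apply.
have Q := sqrD_sqr_gt0 t y0.
rewrite /f /poisson /GRing.scale/=; move: (pi_gt0 R); move: (@pi R) => P P0.
by field; rewrite (gt_eqF P0) (gt_eqF y0) (gt_eqF Q).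
Qed.

(** By evenness this is twice the half-line integral, which the arctangent primitive evaluates to
    $1/2$. *)
Lemma integral_poisson y : 0 < y -> (\int[mu]_t (poisson y t)%:E = 1)%E.
Proof.
move=> y0; rewrite ge0_symfun_integralT; last 3 first.
- by move=> t; exact/ltW/poisson_gt0.
- exact: continuous_poisson.
- by move=> t /=; rewrite poissonN.
have d t := is_derive_poisson_primitive t y0.
have c t : {for t, continuous (fun u : R => pi^-1 * atan (y^-1 * u))}.
  apply: differentiable_continuous; apply/derivable1_diffP.
  exact: (@ex_derive _ _ _ _ _ _ _ (d t)).
rewrite -set_itvcy (@ge0_continuous_FTC2y _ (poisson y)
   (fun u => pi^-1 * atan (y^-1 * u)) 0 (2%:R^-1)).
- by rewrite mulr0 atan0 mulr0 sube0 -EFinM divff.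
- by move=> t _; exact/ltW/poisson_gt0.
- by apply: continuous_subspaceT => t; exact: continuous_poisson.
- rewrite (_ : 2^-1 = pi^-1 * (pi / 2)); last first.
    by rewrite mulrA mulVf ?mul1r// gt_eqF// pi_gt0.
  apply: cvgM; first exact: cvg_cst.
  apply: cvg_comp; last exact: cvgy_atan.
  by apply: gt0_cvgMry; rewrite ?invr_gt0//; exact: cvg_id.
- by move=> t _; exact: (@ex_derive _ _ _ _ _ _ _ (d t)).
- by apply: cvg_at_right_filter; exact: c.
- by move=> t _; rewrite derive1E; exact: (@derive_val _ _ _ _ _ _ _ (d t)).
Qed.

Lemma measurable_poisson y : 0 < y -> measurable_fun setT (poisson y).
Proof.
by move=> y0; apply: continuous_measurable_fun; exact: continuous_poisson.
Qed.

Lemma integrable_poisson y : 0 < y -> mu.-integrable setT (EFin \o poisson y).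
Proof.
move=> y0; apply/integrableP; split.
  by apply/measurable_EFinP; exact: measurable_poisson.
under eq_integral do rewrite /= gtr0_norm ?poisson_gt0//.
by rewrite integral_poisson// ltry.
Qed.

End poisson_kernel.

(** * Real and imaginary parts of negative complex powers *)

Section complex_powers.
Context {R : realType}.
Implicit Types (b : bool) (m : nat) (t y : R).

(* [cpow true m t y] and [cpow false m t y] are the real and imaginary parts of
   [(t + i y)^-m]. *)
Fixpoint cpow b m t y : R :=
  if m is m'.+1 then
    if b then (cpow true m' t y * t + cpow false m' t y * y) / (t ^+ 2 + y ^+ 2)
    else (cpow false m' t y * t - cpow true m' t y * y) / (t ^+ 2 + y ^+ 2)
  else b%:R.

(** With $z=t+iy$, $\partial_y z^{-m}=-im\,z^{-m-1}$, and multiplication by $-i$ sends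
    $(\mathrm{Re},\mathrm{Im})$ to $(\mathrm{Im},-\mathrm{Re})$: hence the sign. *)
Definition dy_sign b m : R := if b then m%:R else - m%:R.

Lemma cpow_sqr m t y : 0 < y ->
  cpow true m t y ^+ 2 + cpow false m t y ^+ 2 = (t ^+ 2 + y ^+ 2)^-1 ^+ m.
Proof.
move=> y0; elim: m => [|m IH] /=; first by rewrite expr0; ring.
rewrite [RHS]exprS -IH; field; rewrite gt_eqF ?sqrD_sqr_gt0//.
Qed.

(** This is $\partial_t z^{-m}=-m z^{-m-1}$. The recursion mixes the two parts, so the induction
    treats both values of [b] together. *)
Lemma is_derive_cpow_x b m t y : 0 < y ->
  is_derive t 1 (fun u => cpow b m u y) (- m%:R * cpow b m.+1 t y).
Proof.
move=> y0; have q0 : t ^+ 2 + y ^+ 2 != 0 by rewrite gt_eqF ?sqrD_sqr_gt0.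
elim: m b => [|m IH] b.
  by rewrite oppr0 mul0r; exact: is_derive_cst.
have dq : is_derive t 1 (fun u : R => (u ^+ 2 + y ^+ 2)^-1)
    (- (t ^+ 2 + y ^+ 2) ^- 2 * (t + t)).
  have : is_derive t 1 (fun u : R => u ^+ 2 + y ^+ 2) (t + t).
    apply: is_derive_eq; rewrite /GRing.scale/=; ring.
  by move=> dq; have := @is_deriveV R (fun u : R => u ^+ 2 + y ^+ 2) t _ 1 q0 dq.
have dt := IH true; have df := IH false.
case: b => /=.
- have dn : is_derive t 1 (fun u => cpow true m u y * u + cpow false m u y * y)
     (- m%:R * cpow true m.+1 t y * t + cpow true m t y
       - m%:R * cpow false m.+1 t y * y).
    apply: is_derive_eq; rewrite /GRing.scale/=; ring.
  apply: is_derive_eq; rewrite /GRing.scale/= -natr1; field.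
  by rewrite q0.
- have dn : is_derive t 1 (fun u => cpow false m u y * u - cpow true m u y * y)
     (- m%:R * cpow false m.+1 t y * t + cpow false m t y
       + m%:R * cpow true m.+1 t y * y).
    apply: is_derive_eq; rewrite /GRing.scale/=; ring.
  apply: is_derive_eq; rewrite /GRing.scale/= -natr1; field.
  by rewrite q0.
Qed.

Lemma is_derive_cpow_y b m t y : 0 < y ->
  is_derive y 1 (fun u => cpow b m t u) (dy_sign b m * cpow (~~ b) m.+1 t y).
Proof.
move=> y0; have q0 : t ^+ 2 + y ^+ 2 != 0 by rewrite gt_eqF ?sqrD_sqr_gt0.
elim: m b => [|m IH] b.
  by case: b; rewrite /dy_sign ?oppr0 mul0r; exact: is_derive_cst.
have dq : is_derive y 1 (fun u : R => (t ^+ 2 + u ^+ 2)^-1)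
    (- (t ^+ 2 + y ^+ 2) ^- 2 * (y + y)).
  have : is_derive y 1 (fun u : R => t ^+ 2 + u ^+ 2) (y + y).
    apply: is_derive_eq; rewrite /GRing.scale/=; ring.
  by move=> dq; have := @is_deriveV R (fun u : R => t ^+ 2 + u ^+ 2) y _ 1 q0 dq.
have dt := IH true; have df := IH false.
case: b => /=.
- have dn : is_derive y 1 (fun u => cpow true m t u * t + cpow false m t u * u)
     (m%:R * cpow false m.+1 t y * t - m%:R * cpow true m.+1 t y * y
       + cpow false m t y).
    apply: is_derive_eq; rewrite /GRing.scale/= /dy_sign; ring.
  apply: is_derive_eq; rewrite /GRing.scale/= /dy_sign -natr1; field.
  by rewrite q0.
- have dn : is_derive y 1 (fun u => cpow false m t u * t - cpow true m t u * u)
     (- m%:R * cpow true m.+1 t y * t - m%:R * cpow false m.+1 t y * y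
       - cpow true m t y).
    apply: is_derive_eq; rewrite /GRing.scale/= /dy_sign; ring.
  apply: is_derive_eq; rewrite /GRing.scale/= /dy_sign -natr1; field.
  by rewrite q0.
Qed.

Lemma le_inv_sqrD d t y : 0 < d -> d <= y ->
  (t ^+ 2 + y ^+ 2)^-1 <= (1 + d ^- 2) / (1 + t ^+ 2).
Proof.
move=> d0 dy; have y0 := lt_le_trans d0 dy.
have t1 := oneD_sqr_gt0 t.
rewrite ler_pdivlMr// ler_pdivrMl ?sqrD_sqr_gt0//.
apply: (@le_trans _ _ ((t ^+ 2 + d ^+ 2) * (1 + d ^- 2))).
  rewrite mulrDr mulr1 mulrDl divff ?expf_neq0 ?gt_eqF//.
  have := sqr_ge0 t; have := sqr_ge0 d.
  have : 0 <= t ^+ 2 / d ^+ 2 by rewrite divr_ge0 ?sqr_ge0.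
  lra.
rewrite ler_wpM2r ?addr_ge0 ?invr_ge0 ?sqr_ge0// lerD2l.
by rewrite ler_sqr ?nnegrE ?(ltW d0) ?(ltW y0).
Qed.

(* For [0 < m], the real part of [(t + i y)^-1] is the only one of these kernels
   that is not [O(1 / t^2)]; it is excluded by [(b < m)%N]. *)
Lemma cpow_bound b m d M : (b < m)%N -> 0 < d ->
  exists2 C, 0 <= C & forall t y, d <= y <= M ->
    `|cpow b m t y| <= C / (1 + t ^+ 2).
Proof.
move=> bm d0.
have [C C0 HC] : exists2 C, 0 <= C & forall t y, d <= y <= M ->
    `|cpow b m t y| <= C * (t ^+ 2 + y ^+ 2)^-1.
  (* Exponent $0$ is excluded. For exponent $1$ only the imaginary part $-y/(t^2+y^2)$ remains,
     whence [C] is $|M|$. For exponent $m+2$ the squared modulus is $(t^2+y^2)^{-(m+2)}$: two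
     factors are kept and each of the others is at most $d^{-2}$. *)
  case: m bm => [|[|m]] bm; first by case: b bm.
    case: b bm => // _; exists `|M| => // t y /andP[dy yM].
    have y0 := lt_le_trans d0 dy.
    rewrite /= mul0r mul1r sub0r normrM normfV (gtr0_norm (sqrD_sqr_gt0 _ y0)).
    rewrite ler_wpM2r ?invr_ge0 ?(ltW (sqrD_sqr_gt0 _ y0))// normrN gtr0_norm//.
    exact: le_trans yM (ler_norm _).
  exists (d^-1 ^+ m); first by rewrite exprn_ge0// invr_ge0 ltW.
  move=> t y /andP[dy yM]; have y0 := lt_le_trans d0 dy.
  have Q0 := sqrD_sqr_gt0 t y0; have Q0' := ltW Q0; have d0' := ltW d0.
  rewrite -ler_sqr ?nnegrE ?mulr_ge0 ?exprn_ge0 ?invr_ge0//.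
  rewrite real_normK ?num_real//.
  apply: (@le_trans _ _ ((t ^+ 2 + y ^+ 2)^-1 ^+ m.+2)).
    by rewrite -cpow_sqr//; case: b {bm}; rewrite ?lerDl ?lerDr sqr_ge0.
  rewrite -[m.+2]addn2 exprD exprMn ler_wpM2r ?exprn_ge0 ?invr_ge0//.
  rewrite -exprM mulnC exprM; apply: lerXn2r; rewrite ?nnegrE ?exprn_ge0 ?invr_ge0//.
  rewrite exprVn lef_pV2 ?posrE ?exprn_gt0// (@le_trans _ _ (y ^+ 2))//.
    by rewrite ler_sqr ?nnegrE// (ltW y0).
  by rewrite lerDr sqr_ge0.
exists (C * (1 + d ^- 2)).
  by rewrite mulr_ge0// addr_ge0 ?invr_ge0 ?sqr_ge0.
move=> t y /[dup] /andP[dy _] /(HC t) /le_trans; apply.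
by rewrite -mulrA ler_wpM2l// le_inv_sqrD.
Qed.

(** Peetre's inequality: recentring the weight costs a factor quadratic in [x], uniformly in [t]. It
    rests on $2+2x^2+2(t-x)^2-(1+t^2)=1+(t-2x)^2$. *)
Lemma peetre t x : (1 + (t - x) ^+ 2)^-1 <= 2 * (1 + x ^+ 2) / (1 + t ^+ 2).
Proof.
rewrite ler_pdivlMr ?oneD_sqr_gt0// ler_pdivrMl ?oneD_sqr_gt0//.
have := sqr_ge0 (t - x - x); have := mulr_ge0 (sqr_ge0 x) (sqr_ge0 (t - x)).
set a := x ^+ 2 * (t - x) ^+ 2 => a0 H.
rewrite [leRHS](_ : _ = 2 + 2 * (x ^+ 2 + (t - x) ^+ 2) + 2 * a); last first.
  rewrite /a; ring.
apply: (@le_trans _ _ (2 + 2 * (x ^+ 2 + (t - x) ^+ 2))); last by lra.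
rewrite -subr_ge0 (_ : _ - _ = 1 + (t - x - x) ^+ 2); last by ring.
lra.
Qed.

End complex_powers.

(** * Integrals against the kernels: growth, derivatives, joint continuity *)

Section kernel_integrals.
Context {R : realType}.
Local Notation mu := (@lebesgue_measure R).
Implicit Types (b : bool) (m : nat) (x y d M : R) (F : R -> R).

(** A condition free of [p] that suffices for all kernel integrals. Measurability of [F] is listed
    apart because the integrability condition sees only $|F|$. *)
Definition weighted_integrable F := measurable_fun setT F /\
  mu.-integrable setT (EFin \o (fun xi => `|F xi| / (1 + xi ^+ 2))).

(** Centring the kernel at $\xi-x$ turns the factor $-m$ of $\partial_t$ into $+m$ for
    $\partial_x$. *)
Definition cint F b m x y : R :=
  \int[mu]_xi (F xi * cpow b m (xi - x) y).

Let w_gt0 := @oneD_sqr_gt0 R.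

Lemma integrable_EFinZl (f : R -> R) (k : R) : mu.-integrable setT (EFin \o f) ->
  mu.-integrable setT (EFin \o (fun x => k * f x)).
Proof.
move=> fi; rewrite (_ : _ \o _ = fun x => (k%:E * (EFin \o f) x)%E)//.
exact: integrableZl.
Qed.

Lemma cpow_shift_bound b m d M : (b < m)%N -> 0 < d ->
  exists2 C, 0 <= C & forall x xi y, d <= y <= M ->
    `|cpow b m (xi - x) y| <= C * (1 + x ^+ 2) / (1 + xi ^+ 2).
Proof.
move=> bm d0; have [C C0 HC] := cpow_bound M bm d0.
exists (C * 2); first by rewrite mulr_ge0.
move=> x xi y /(HC (xi - x)) /le_trans; apply.
by rewrite -!mulrA ler_wpM2l// mulrA peetre.
Qed.

Lemma continuous_cpow_shift b m x y : 0 < y ->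
  continuous (fun xi => cpow b m (xi - x) y).
Proof.
move=> y0 xi.
apply: (@continuous_comp _ _ _ (fun v : R => v - x) (fun u => cpow b m u y)).
  by apply: cvgB; [exact: cvg_id|exact: cvg_cst].
apply: differentiable_continuous; apply/derivable1_diffP.
exact: (@ex_derive _ _ _ _ _ _ _ (is_derive_cpow_x b m _ y0)).
Qed.

Lemma integrableM_weighted F (k : R -> R) (C : R) : weighted_integrable F ->
  measurable_fun setT k -> (forall xi, `|k xi| <= C / (1 + xi ^+ 2)) ->
  mu.-integrable setT (EFin \o (fun xi => F xi * k xi)).
Proof.
move=> [mF iF] mk kC.
have iG : mu.-integrable setT
    (EFin \o (fun xi => C * (`|F xi| / (1 + xi ^+ 2)))) by exact: integrable_EFinZl.
apply: (le_integrable measurableT _ _ iG).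
- by apply/measurable_EFinP; exact: measurable_funM.
- move=> xi _ /=; rewrite lee_fin normrM [leRHS]ger0_norm.
    by rewrite mulrCA ler_wpM2l.
  have C0 : 0 <= C.
    have := le_trans (normr_ge0 _) (kC 0).
    by rewrite pmulr_lge0// invr_gt0.
  by rewrite mulr_ge0// divr_ge0// ltW.
Qed.

Lemma integrable_cint F b m x y : weighted_integrable F ->
  (b < m)%N -> 0 < y ->
  mu.-integrable setT (EFin \o (fun xi => F xi * cpow b m (xi - x) y)).
Proof.
move=> wF bm y0; have [C C0 HC] := cpow_shift_bound y bm y0.
apply: (@integrableM_weighted _ _ (C * (1 + x ^+ 2))) => //.
  by apply: continuous_measurable_fun; exact: continuous_cpow_shift.
by move=> xi; apply: HC; rewrite lexx.
Qed.

(** The quadratic growth comes from Peetre's inequality. Uniformity in [y] serves joint continuity;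
    the growth rate serves the integrations by parts. *)
Lemma cint_bound F b m d M : weighted_integrable F -> (b < m)%N -> 0 < d ->
  exists2 C, 0 <= C & forall x y, d <= y <= M ->
    `|cint F b m x y| <= C * (1 + x ^+ 2).
Proof.
move=> wF bm d0; have [C C0 HC] := cpow_shift_bound M bm d0.
have [mF iF] := wF.
set I := \int[mu]_xi (`|F xi| / (1 + xi ^+ 2)).
have I0 : 0 <= I by apply: Rintegral_ge0 => xi _; rewrite divr_ge0// ltW.
exists (C * I); first exact: mulr_ge0.
move=> x y /[dup] dyM /andP[dy _]; have y0 := lt_le_trans d0 dy.
have iK := integrable_cint x wF bm y0.
apply: le_trans (le_normr_Rintegral _ iK) _ => //.
rewrite mulrAC -RintegralZl//; apply: le_Rintegral => //.
- by have := integrable_norm iK.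
- exact: integrable_EFinZl.
- move=> xi _; rewrite normrM mulrCA ler_wpM2l//; exact: HC.
Qed.

(** Differentiation under the integral sign, with majorant $C|F(\xi)|/(1+\xi^2)$ on an interval
    around [a]. *)
Lemma is_derive_Rintegral F (k dk : R -> R -> R) (a r C : R) :
  weighted_integrable F -> 0 < r ->
  (forall u, u \in `]a - r, a + r[ ->
    mu.-integrable setT (EFin \o (fun xi => F xi * k u xi))) ->
  (forall u xi, u \in `]a - r, a + r[ -> is_derive u 1 (k ^~ xi) (dk u xi)) ->
  (forall u xi, u \in `]a - r, a + r[ -> `|dk u xi| <= C / (1 + xi ^+ 2)) ->
  is_derive a 1 (fun u => \int[mu]_xi (F xi * k u xi))
    (\int[mu]_xi (F xi * dk a xi)).
Proof.
move=> [mF iF] r0 ik dk_k dkC.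
have aI : `]a - r, a + r[%classic a by rewrite /= in_itv/=; lra.
have C0 : 0 <= C.
  have := le_trans (normr_ge0 _) (dkC a 0 aI).
  by rewrite pmulr_lge0// invr_gt0.
pose f u xi := F xi * k u xi.
have df u xi : `]a - r, a + r[%classic u ->
    is_derive u 1 (f ^~ xi) (F xi * dk u xi).
  by move=> uI; have := @is_deriveZ _ _ _ _ (F xi) _ _ _ (dk_k u xi uI).
have d1 u xi : `]a - r, a + r[%classic u -> partial1of2 f u xi = F xi * dk u xi.
  move=> uI; rewrite partial1of2E; exact: (@derive_val _ _ _ _ _ _ _ (df u xi uI)).
have derf u xi : `]a - r, a + r[%classic u -> [set: R] xi -> derivable (f ^~ xi) u 1.
  move=> uI _; exact: (@ex_derive _ _ _ _ _ _ _ (df u xi uI)).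
pose G xi := C * (`|F xi| / (1 + xi ^+ 2)).
have G0 xi : 0 <= G xi by rewrite mulr_ge0// divr_ge0// ltW.
have iG : mu.-integrable setT (EFin \o G) by exact: integrable_EFinZl.
have fG u xi : `]a - r, a + r[%classic u -> [set: R] xi ->
    `|partial1of2 f u xi| <= G xi.
  move=> uI _; rewrite d1// normrM /G mulrCA ler_wpM2l//; exact: dkC.
apply: DeriveDef.
  exact: (derivable_under_integral measurableT aI ik derf G0 iG fG).
rewrite -derive1E (differentiation_under_integral measurableT aI ik derf G0 iG fG).
by apply: eq_Rintegral => xi _; rewrite d1.
Qed.

Lemma is_derive_cint_x F b m x y : weighted_integrable F ->
  (b < m)%N -> 0 < y ->
  is_derive x 1 (fun u => cint F b m u y) (m%:R * cint F b m.+1 x y).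
Proof.
move=> wF bm y0.
have bm1 : (b < m.+1)%N by rewrite ltnW.
have [C C0 HC] := cpow_shift_bound y bm1 y0.
pose dk u xi := m%:R * cpow b m.+1 (xi - u) y.
(* On the interval of radius $1$ around [x] one has $|u|\le|x|+1$, which makes the shifted kernel
   bound independent of [u]. *)
have := @is_derive_Rintegral F (fun u xi => cpow b m (xi - u) y) dk x 1
  (m%:R * (C * (1 + (`|x| + 1) ^+ 2))) wF ltr01.
rewrite /dk (_ : \int[mu]_xi _ = m%:R * cint F b m.+1 x y); last first.
  rewrite /cint -RintegralZl//; last exact: integrable_cint.
  by apply: eq_Rintegral => xi _; rewrite mulrCA.
apply.
- by move=> u _; exact: integrable_cint.
- move=> u xi _.
  have d1 : is_derive u 1 (fun v : R => xi - v) (-1).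
    by apply: is_derive_eq; rewrite add0r mul1r.
  have := @is_derive1_comp R (fun t => cpow b m t y) (fun v => xi - v) u _ _
    (is_derive_cpow_x b m (xi - u) y0) d1.
  by move=> /is_derive_eq; apply; rewrite mulrN1 mulNr opprK.
- move=> u xi; rewrite in_itv/= => /andP[u1 u2].
  rewrite normrM ger0_norm// -!mulrA ler_wpM2l//.
  apply: (le_trans (HC u xi y _)); first by rewrite lexx.
  rewrite -mulrA ler_wpM2l// ler_wpM2r ?invr_ge0 ?(ltW (w_gt0 _))//.
  rewrite lerD2l -[u ^+ 2]real_normK ?num_real// ler_sqr ?nnegrE ?addr_ge0//.
  rewrite ler_norml; have := ler_norm x; have := ler_norm (- x).
  by rewrite normrN; lra.
Qed.

Lemma is_derive_cint_y F b m x y : weighted_integrable F ->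
  (b < m)%N -> 0 < y ->
  is_derive y 1 (cint F b m x) (@dy_sign R b m * cint F (~~ b) m.+1 x y).
Proof.
move=> wF bm y0.
(* Swapping the parts stays in the admissible range: the real part can only appear with exponent at
   least $2$. *)
have bm1 : (~~ b < m.+1)%N by case: b m bm => -[|[|]].
have y20 : 0 < y / 2 by rewrite divr_gt0.
have [C C0 HC] := cpow_shift_bound (2 * y) bm1 y20.
pose dk u xi := @dy_sign R b m * cpow (~~ b) m.+1 (xi - x) u.
have := @is_derive_Rintegral F (fun u xi => cpow b m (xi - x) u) dk y (y / 2)
  (`|@dy_sign R b m| * (C * (1 + x ^+ 2))) wF y20.
rewrite /dk (_ : \int[mu]_xi _ = @dy_sign R b m * cint F (~~ b) m.+1 x y); last first.
  rewrite /cint -RintegralZl//; last exact: integrable_cint.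
  by apply: eq_Rintegral => xi _; rewrite mulrCA.
(* Radius $y/2$ keeps the heights in $[y/2,2y]$, away from the boundary, where the kernel bound is
   uniform. *)
have H (u : R) : u \in `]y - y / 2, y + y / 2[ -> y / 2 <= u <= 2 * y /\ 0 < u.
  by rewrite in_itv/= => /andP[? ?]; split; lra.
apply.
- by move=> u /H[_ u0]; exact: integrable_cint.
- by move=> u xi /H[_ u0]; exact: is_derive_cpow_y.
- move=> u xi /H[uI _]; rewrite normrM -!mulrA ler_wpM2l//.
  by apply: (le_trans (HC x xi u uI)); rewrite -mulrA.
Qed.

(** The mean value theorem, applied on either side of [a]. *)
Lemma lipschitz_is_derive (f df : R -> R) (L a c r : R) :
  (forall u, `|u - a| < r -> is_derive u 1 f (df u)) ->
  (forall u, `|u - a| < r -> `|df u| <= L) ->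
  `|c - a| < r -> `|f c - f a| <= L * `|c - a|.
Proof.
move=> dfE dfL car.
have key (s t : R) : s <= t -> (forall u, u \in `[s, t] -> `|u - a| < r) ->
    `|f t - f s| <= L * `|t - s|.
  move=> st H.
  have [| |u uI ->] := @MVT_segment R f df s t st.
  - move=> u uI; apply: dfE; apply: H.
    exact: (subset_itv_oo_cc uI).
  - apply: derivable_within_continuous => u uI.
    exact: (@ex_derive _ _ _ _ _ _ _ (dfE u (H u uI))).
  - by rewrite normrM ler_wpM2r//; exact/dfL/H.
have [ac|/ltW ca] := leP a c.
  apply: key => // u; rewrite in_itv/= => /andP[au uc].
  apply: le_lt_trans car; rewrite !ger0_norm ?subr_ge0//; lra.
rewrite distrC [`|c - a|]distrC; apply: key => // u.
rewrite in_itv/= => /andP[cu ua]; apply: le_lt_trans car.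
by rewrite distrC [`|c - a|]distrC !ger0_norm ?subr_ge0//; lra.
Qed.

(** The increment is split into a move in [x] at height [z.2], controlled by a Lipschitz constant
    uniform for heights in $[y_0/2,2y_0]$, and a move in [y] at fixed $x_0$, controlled by
    differentiability. *)
Lemma continuous_cint F b m (z : R * R) : weighted_integrable F ->
  (b < m)%N -> 0 < z.2 ->
  {for z, continuous (fun z : R * R => cint F b m z.1 z.2)}.
Proof.
case: z => x0 y0 /= wF bm y0_gt0.
have bm1 : (b < m.+1)%N by rewrite ltnW.
have y20 : 0 < y0 / 2 by rewrite divr_gt0.
have [C C0 HC] := cint_bound (2 * y0) wF bm1 y20.
pose L := m%:R * (C * (1 + (`|x0| + 1) ^+ 2)).
have L0 : 0 <= L by rewrite !mulr_ge0// ltW.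
suff : (cint F b m z.1 z.2 - cint F b m x0 z.2) + cint F b m x0 z.2
    @[z --> (x0, y0)] --> 0 + cint F b m x0 y0.
  rewrite add0r; under eq_fun do rewrite subrK; exact.
apply: cvgD; last first.
  apply: (@cvg_comp _ _ _ snd (cint F b m x0)); first exact: cvg_snd.
  apply: differentiable_continuous; apply/derivable1_diffP.
  exact: (@ex_derive _ _ _ _ _ _ _ (is_derive_cint_y x0 wF bm y0_gt0)).
apply/cvgr0Pnorm_le => e e0.
(* Dividing by $L+1$ covers the case $L=0$. *)
have eL : 0 < e / (L + 1) by rewrite divr_gt0// ltr_wpDl.
near=> z.
have zy : y0 / 2 <= z.2 <= 2 * y0.
  near: z.
  have : \forall t \near y0, y0 / 2 <= t <= 2 * y0.
    have /cvgrPdist_lt/(_ _ y20) : t @[t --> y0] --> y0 by exact: cvg_id.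
    by apply: filterS => t; rewrite ltr_norml => /andP[? ?]; lra.
  move=> H; have := @cvg_snd R R (nbhs x0) (nbhs y0) _ _ H; exact.
have zx : `|z.1 - x0| < 1 /\ `|z.1 - x0| <= e / (L + 1).
  near: z.
  have : \forall t \near x0, `|t - x0| < 1 /\ `|t - x0| <= e / (L + 1).
    near=> t; split; [|apply: ltW]; near: t.
      have /cvgrPdist_lt/(_ _ ltr01) : t @[t --> x0] --> x0 by exact: cvg_id.
      by apply: filterS => t; rewrite distrC.
    have /cvgrPdist_lt/(_ _ eL) : t @[t --> x0] --> x0 by exact: cvg_id.
    by apply: filterS => t; rewrite distrC.
  move=> H; have := @cvg_fst R R (nbhs x0) (nbhs y0) _ _ H; exact.
have z20 : 0 < z.2 by case/andP: zy; lra.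
have [zx1 zx2] := zx.
apply: le_trans (@lipschitz_is_derive (fun u => cint F b m u z.2)
  (fun u => m%:R * cint F b m.+1 u z.2) L x0 z.1 1 _ _ zx1) _.
- by move=> u _; exact: is_derive_cint_x.
- move=> u ux; rewrite normrM ger0_norm// ler_wpM2l//.
  apply: le_trans (HC _ _ zy) _; rewrite ler_wpM2l//.
  rewrite lerD2l -[u ^+ 2]real_normK ?num_real// ler_sqr ?nnegrE ?addr_ge0//.
  rewrite -[u](subrK x0) addrC; apply: le_trans (ler_normD _ _) _.
  by rewrite lerD2l ltW.
apply: le_trans (ler_wpM2l L0 zx2) _.
rewrite mulrCA ler_piMr// ?(ltW e0)// ler_pdivrMr ?ltr_wpDl// mul1r.
by rewrite lerDl.
Unshelve. all: end_near. Qed.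

End kernel_integrals.

(** * Harmonicity and the formulas for the derivatives of the Poisson integral *)

Section poisson_harmonic.
Context {R : realType}.
Local Notation mu := (@lebesgue_measure R).
Implicit Types (b : bool) (m n : nat) (x y : R) (F : R -> R).

Lemma open_upper_half_plane : open (@upper_half_plane R).
Proof.
rewrite (_ : @upper_half_plane R = snd @^-1` [set t : R | 0 < t])//.
by apply: open_comp => [z _|]; [exact: cvg_snd|exact: open_gt].
Qed.

(* Real and imaginary parts of the powers of [(xi - x) + i y] are exchanged by
   differentiation in [y], so that the family [cint F] is stable under both
   partial derivatives. *)
Lemma cint_partials F b m (c : R) (w : R * R -> R) :
  weighted_integrable F -> (b < m)%N ->
  (forall z, 0 < z.2 -> w z = c * cint F b m z.1 z.2) ->
  (forall z, 0 < z.2 -> [/\ has_pdx w z, has_pdy w z & {for z, continuous w}]) /\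
  (forall z, 0 < z.2 -> pdx w z = c * m%:R * cint F b m.+1 z.1 z.2) /\
  (forall z, 0 < z.2 ->
     pdy w z = c * @dy_sign R b m * cint F (~~ b) m.+1 z.1 z.2).
Proof.
move=> wF bm wE.
have dx (z : R * R) : 0 < z.2 -> is_derive z.1 1 (fun t => w (t, z.2))
    (c * m%:R * cint F b m.+1 z.1 z.2).
  move=> z0; have := is_derive_cint_x z.1 wF bm z0.
  rewrite (_ : (fun t => w (t, z.2)) = c \*: (fun t => cint F b m t z.2)).
    by move=> d; have := is_deriveZ c d => /is_derive_eq; apply; rewrite -mulrA.
  by apply/funext => t; rewrite wE.
have dy (z : R * R) : 0 < z.2 -> is_derive z.2 1 (fun t => w (z.1, t))
    (c * @dy_sign R b m * cint F (~~ b) m.+1 z.1 z.2).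
  move=> z0; have := is_derive_cint_y z.1 wF bm z0 => /(is_deriveZ c) d.
  (* Along a vertical line [w] has the prescribed form only at positive heights, so the two
     functions agree only near [z.2]. *)
  apply: near_eq_is_derive (is_derive_eq d _); last by rewrite -mulrA.
  near=> t; rewrite wE//=; near: t; exact: lt_nbhsr.
split; [|split].
- move=> z z0; split.
  + exact: (@ex_derive _ _ _ _ _ _ _ (dx z z0)).
  + exact: (@ex_derive _ _ _ _ _ _ _ (dy z z0)).
  + suff : w t @[t --> z] --> c * cint F b m z.1 z.2 by rewrite -wE.
    apply: cvg_trans (cvgM (cvg_cst c) (continuous_cint wF bm z0)).
    apply: near_eq_cvg; near=> t; rewrite wE//.
    by near: t; exact: (open_nbhs_nbhs (conj open_upper_half_plane z0)).
- by move=> z z0; rewrite /pdx derive1E (@derive_val _ _ _ _ _ _ _ (dx z z0)).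
- by move=> z z0; rewrite /pdy derive1E (@derive_val _ _ _ _ _ _ _ (dy z z0)).
Unshelve. all: end_near. Qed.

(** Two rounds of [cint_partials] give the second derivatives $\pm c\,m(m+1)$ times the same
    integral, with opposite signs. *)
Lemma harmonic_cint F m (c : R) (w : R * R -> R) :
  weighted_integrable F -> (0 < m)%N ->
  (forall z, 0 < z.2 -> w z = c * cint F false m z.1 z.2) ->
  harmonic_on (@upper_half_plane R) w.
Proof.
move=> wF m0 wE.
have [w0 [wx wy]] := cint_partials wF (m0 : (false < m)%N) wE.
have [wx0 [wxx wxy]] := cint_partials wF (ltnW (m0 : (0 < m)%N) : (false < m.+1)%N) wx.
have [wy0 [wyx wyy]] := cint_partials wF (m0 : (true < m.+1)%N) wy.
have lt2 b : (b < m.+2)%N by case: b.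
(* The third round supplies only the continuity of the four second partial derivatives. *)
have [wxx0 _] := cint_partials wF (lt2 _) wxx.
have [wxy0 _] := cint_partials wF (lt2 _) wxy.
have [wyx0 _] := cint_partials wF (lt2 _) wyx.
have [wyy0 _] := cint_partials wF (lt2 _) wyy.
split; [exact: open_upper_half_plane|split] => z z0.
  have [a1 a2 a3] := w0 z z0; have [b1 b2 b3] := wx0 z z0.
  have [c1 c2 c3] := wy0 z z0; have [_ _ d1] := wxx0 z z0.
  have [_ _ d2] := wxy0 z z0; have [_ _ d3] := wyx0 z z0.
  have [_ _ d4] := wyy0 z z0.
  exact: (conj (conj a1 (conj a2 (conj b1 (conj b2 (conj c1 c2)))))
    (conj a3 (conj b3 (conj c3 (conj d1 (conj d2 (conj d3 d4))))))).
by rewrite wxx// wyy// /dy_sign/=; ring.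
Qed.

Lemma poissonE x y : 0 < y -> poisson y x = - pi^-1 * cpow false 1 x y.
Proof.
move=> y0; rewrite /poisson /= invfM.
by move: (@pi R)^-1 (x ^+ 2 + y ^+ 2)^-1 => a b; ring.
Qed.

Lemma derive1n_poisson_shift n x y : 0 < y ->
  derive1n n (fun t => poisson y (t - x)) =
  fun t => - pi^-1 * ((-1) ^+ n * n`!%:R) * cpow false n.+1 (t - x) y.
Proof.
move=> y0; elim: n => [|n IH].
  by apply/funext => t; rewrite derive1n0 poissonE// expr0 fact0 !mulr1.
rewrite derive1nS IH; apply/funext => t; rewrite derive1E.
set k := - pi^-1 * _.
have d1 : is_derive t 1 (fun v : R => v - x) 1.
  by apply: is_derive_eq; rewrite oppr0 addr0.
have := @is_derive1_comp R (fun s => cpow false n.+1 s y) (fun v => v - x) t _ _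
    (is_derive_cpow_x false n.+1 (t - x) y0) d1.
move=> /(is_deriveZ k) d.
rewrite (@derive_val _ _ _ _ _ _ _ d) /k exprS factS natrM /GRing.scale/= mulr1.
by move: (@pi R)^-1 => a; ring.
Qed.

Lemma integrable_poisson_integrand n F x y : weighted_integrable F -> 0 < y ->
  mu.-integrable setT (EFin \o poisson_integrand n F y x).
Proof.
move=> wF y0; rewrite /poisson_integrand derive1n_poisson_shift//.
set k := - pi^-1 * _.
rewrite (_ : (fun xi => _) = fun xi => k * (F xi * cpow false n.+1 (xi - x) y)).
  by apply: integrable_EFinZl; exact: integrable_cint.
by apply/funext => xi; rewrite mulrCA.
Qed.

(** The sign $(-1)^n$ in the definition of $u_y$ cancels the one produced by differentiating the
    kernel $n$ times in $\xi$. *)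
Lemma poissonuE n F x y : weighted_integrable F -> 0 < y ->
  poissonu n F y x = - pi^-1 * n`!%:R * cint F false n.+1 x y.
Proof.
move=> wF y0; rewrite /poissonu /poisson_integrand derive1n_poisson_shift//.
set k := - pi^-1 * _.
rewrite (_ : (fun xi => _) = fun xi => k * (F xi * cpow false n.+1 (xi - x) y));
  last by apply/funext => xi; rewrite mulrCA.
rewrite RintegralZl//; last exact: integrable_cint.
have sg : (-1) ^+ n * (-1) ^+ n = 1 :> R by rewrite -expr2 sqrr_sign.
rewrite -/(cint F false n.+1 x y) /k.
move: (@pi R)^-1 ((-1) ^+ n : R) sg (n`!%:R : R) => a sn sg f.
by transitivity (sn * sn * (- a * f * cint F false n.+1 x y));
  [ring|rewrite sg mul1r].
Qed.

Lemma poissonUE F x y : 0 < y -> weighted_integrable F ->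
  poissonU F y x = - pi^-1 * cint F false 1 x y.
Proof.
move=> y0 wF; rewrite /poissonU /cint -RintegralZl//; last exact: integrable_cint.
apply: eq_Rintegral => xi _.
by rewrite -poissonN opprB poissonE// mulrCA.
Qed.

(** Differentiation in [x] produces the factors $1,2,\dots,n$ without signs; the result is the
    expression found for $u_y$, which is the identity in (a). *)
Lemma derive1n_poissonU n F y : weighted_integrable F -> 0 < y ->
  derive1n n (poissonU F y) =
  fun x => - pi^-1 * n`!%:R * cint F false n.+1 x y.
Proof.
move=> wF y0; elim: n => [|n IH].
  by apply/funext => t; rewrite derive1n0 poissonUE// fact0 mulr1.
rewrite derive1nS IH; apply/funext => t; rewrite derive1E.
set k := - pi^-1 * _.
have d := is_deriveZ k (is_derive_cint_x t wF (isT : (false < n.+1)%N) y0).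
rewrite (@derive_val _ _ _ _ _ _ _ d) /k factS natrM /GRing.scale/=.
by move: (@pi R)^-1 => a; ring.
Qed.

Lemma derivable_derive1n_poissonU n F x y : weighted_integrable F -> 0 < y ->
  derivable (derive1n n (poissonU F y)) x 1.
Proof.
move=> wF y0; rewrite derive1n_poissonU//; set k := - pi^-1 * _.
have d := is_deriveZ k (is_derive_cint_x x wF (isT : (false < n.+1)%N) y0).
exact: (@ex_derive _ _ _ _ _ _ _ d).
Qed.

End poisson_harmonic.

(** * Integration by parts against Schwartz functions *)

Section distributional_derivative.
Context {R : realType}.
Local Notation mu := (@lebesgue_measure R).
Implicit Types (f g phi : R -> R) (j k n : nat).

Let w_gt0 := @oneD_sqr_gt0 R.

Lemma integrable_inv_oneDsqr :
  mu.-integrable setT (EFin \o (fun x : R => (1 + x ^+ 2)^-1)).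
Proof.
have := integrable_EFinZl pi (integrable_poisson (@ltr01 R)).
congr integrable; apply/funext => x /=; congr EFin.
by rewrite /poisson expr1n mul1r invfM mulrA divff ?mul1r ?(addrC 1)// gt_eqF// pi_gt0.
Qed.

Lemma integrable_oneDsqr_bound f (C : R) : measurable_fun setT f ->
  (forall x, `|f x| <= C / (1 + x ^+ 2)) -> mu.-integrable setT (EFin \o f).
Proof.
move=> mf fC; have iG := integrable_EFinZl C integrable_inv_oneDsqr.
apply: (le_integrable measurableT _ _ iG); first exact/measurable_EFinP.
by move=> x _ /=; rewrite lee_fin (le_trans (fC x))// ler_norm.
Qed.

(** The fundamental theorem on growing symmetric intervals leaves boundary values that tend to $0$,
    while dominated convergence recovers the full integral. *)
Lemma Rintegral_derivative_eq0 g (dg : R -> R) (C : R) :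
  (forall x : R, is_derive x 1 g (dg x)) -> continuous dg ->
  mu.-integrable setT (EFin \o dg) ->
  (forall x, `|g x| <= C / (1 + x ^+ 2)) -> \int[mu]_x dg x = 0.
Proof.
move=> gdg cdg idg gC.
have C0 : 0 <= C.
  by have := le_trans (normr_ge0 _) (gC 0); rewrite pmulr_lge0// invr_gt0.
have cg x : {for x, continuous g}.
  apply: differentiable_continuous; apply/derivable1_diffP.
  exact: (@ex_derive _ _ _ _ _ _ _ (gdg x)).
(* The successor keeps the interval nondegenerate for $n=0$, as the fundamental theorem requires. *)
pose I n : set R := `[- n.+1%:R, n.+1%:R]%classic.
pose f_ n := ((EFin \o dg) \_ (I n))%E.
have mdg : measurable_fun setT (EFin \o dg) by case/integrableP: idg.
have mf_ n : measurable_fun setT (f_ n).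
  apply/(measurable_restrictT _ _).1 => //; first exact: measurable_itv.
  exact: measurable_funTS.
have cf : {ae mu, forall x, setT x -> f_ ^~ x @ \oo --> (EFin \o dg) x}.
  apply: aeW => x _; apply: cvg_near_cst; near=> n.
  rewrite /f_ patchE ifT// inE /I/= in_itv/= -ler_norml.
  apply: (@le_trans _ _ n%:R); last by rewrite ler_nat.
  near: n; exact: nbhs_infty_ger.
have bf : {ae mu, forall x n, setT x -> (`|f_ n x| <= `|(EFin \o dg) x|)%E}.
  apply: aeW => x n _; rewrite /f_ patchE; case: ifPn => // _.
  by rewrite abse0.
have [_ _ H] := @dominated_convergence _ _ R mu setT measurableT f_ (EFin \o dg)
  _ mf_ mdg cf (integrable_abse idg) bf.
have intE n : (\int[mu]_x f_ n x = (g n.+1%:R - g (- n.+1%:R))%:E)%E.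
  rewrite /f_ -integral_mkcond (@continuous_FTC2 _ dg g).
  - by rewrite EFinB.
  - by rewrite (@lt_trans _ _ 0)// oppr_lt0.
  - by apply: continuous_subspaceT => x; exact: cdg.
  - split.
    + by move=> x _; exact: (@ex_derive _ _ _ _ _ _ _ (gdg x)).
    + by apply: cvg_at_right_filter; exact: cg.
    + by apply: cvg_at_left_filter; exact: cg.
  - by move=> x _; rewrite derive1E (@derive_val _ _ _ _ _ _ _ (gdg x)).
rewrite /Rintegral.
suff H0 : (fun n => \int[mu]_x f_ n x)%E @ \oo --> 0%E.
  by rewrite (cvg_unique _ H H0)//; exact: ereal_hausdorff.
rewrite (_ : (fun n => _) = EFin \o (fun n => g n.+1%:R - g (- n.+1%:R))); last first.
  exact/funext.
apply: cvg_EFin; first exact: nearW.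
apply/cvgr0Pnorm_le => e e0.
near=> n => /=.
have b (s : R) : `|s| = n.+1%:R -> `|g s| <= e / 2.
  move=> sn; apply: (le_trans (gC s)).
  rewrite ler_pdivrMr//.
  have ns : s ^+ 2 = n.+1%:R ^+ 2 by rewrite -sn real_normK ?num_real.
  have n1 : 1 <= n.+1%:R :> R by rewrite ler1n.
  have Cn : C / (e / 2) <= n.+1%:R.
    apply: (@le_trans _ _ n%:R); last by rewrite ler_nat.
    near: n; exact: nbhs_infty_ger.
  rewrite -ler_pdivrMl ?divr_gt0// mulrC (le_trans Cn)// ns.
  by nra.
apply: le_trans (ler_normB _ _) _; rewrite (splitr e) lerD// b ?normrN//.
all: by rewrite ger0_norm.
Unshelve. all: end_near. Qed.

(** The moments of orders $0$ and $4$ suffice since $(1+x^2)^2\le2(1+x^4)$. Of the two factors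
    $1+x^2$ gained, one absorbs the growth of [G] and the other leaves an integrable weight. *)
Lemma schwartz_bound phi j : schwartz phi ->
  exists2 M : R, 0 <= M &
    forall x, `|derive1n j phi x| <= M / (1 + x ^+ 2) ^+ 2.
Proof.
move=> [_ sphi]; have [M0 H0] := sphi j 0; have [M4 H4] := sphi j 4.
have P x : `|derive1n j phi x| <= 2 * (M0 + M4) / (1 + x ^+ 2) ^+ 2.
  rewrite ler_pdivlMr ?exprn_gt0// mulrC.
  apply: (@le_trans _ _ (2 * (1 + x ^+ 4) * `|derive1n j phi x|)).
    rewrite ler_wpM2r// -subr_ge0 (_ : _ - _ = (1 - x ^+ 2) ^+ 2) ?sqr_ge0//.
    by ring.
  have := H0 x; have := H4 x; rewrite expr0 mul1r.
  by rewrite -normrX ger0_norm ?exprn_even_ge0//; move: `|_| => ? ? ?; lra.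
exists (2 * (M0 + M4)) => //.
have := le_trans (normr_ge0 _) (P 0).
by rewrite pmulr_lge0// invr_gt0 exprn_gt0.
Qed.

Section parts.
Variables (G phi : R -> R).
Hypothesis dG : forall k (x : R), derivable (derive1n k G) x 1.
Hypothesis bG : forall k, exists2 C : R, 0 <= C &
  forall x, `|derive1n k G x| <= C * (1 + x ^+ 2).
Hypothesis sphi : schwartz phi.

Lemma parts_bound k j : exists C : R, forall x,
  `|derive1n k G x * derive1n j phi x| <= C / (1 + x ^+ 2).
Proof.
have [C C0 HC] := bG k; have [M M0 HM] := schwartz_bound j sphi.
exists (C * M) => x; rewrite normrM.
apply: le_trans (ler_pM _ _ (HC x) (HM x)) _ => //.
rewrite le_eqVlt; apply/orP; left; apply/eqP; field.
by rewrite gt_eqF.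
Qed.

Let cont (f : R -> R) : (forall x, derivable f x 1) -> continuous f.
Proof.
by move=> df x; apply: differentiable_continuous; apply/derivable1_diffP.
Qed.

Lemma integrable_parts k j : mu.-integrable setT
  (EFin \o (fun x => derive1n k G x * derive1n j phi x)).
Proof.
have [C HC] := parts_bound k j; apply: integrable_oneDsqr_bound HC.
by apply: measurable_funM; apply: continuous_measurable_fun; apply: cont;
  [exact: dG|case: sphi].
Qed.

(** The two integrals add up to that of the derivative of a product decaying like $1/(1+x^2)$. *)
Lemma Rintegral_parts k j :
  \int[mu]_x (derive1n k.+1 G x * derive1n j phi x) =
  - \int[mu]_x (derive1n k G x * derive1n j.+1 phi x).
Proof.
have [C HC] := parts_bound k j; have [dphi _] := sphi.
apply/eqP; rewrite -subr_eq0 opprK -RintegralD ?integrable_parts//; apply/eqP.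
apply: (Rintegral_derivative_eq0 _ _ _ HC).
- move=> x.
  have d1 : is_derive x 1 (derive1n k G) (derive1n k.+1 G x).
    by apply: DeriveDef => //; rewrite derive1nS derive1E.
  have d2 : is_derive x 1 (derive1n j phi) (derive1n j.+1 phi x).
    by apply: DeriveDef => //; rewrite derive1nS derive1E.
  have := is_deriveM d1 d2 => /is_derive_eq; apply.
  by rewrite /GRing.scale/= addrC mulrC.
- by move=> x; apply: cvgD; apply: cvgM; apply: cont;
  [exact: dG|exact: dphi..|exact: dG|exact: dphi].
- have := @integrableD _ _ R mu setT measurableT _ _
    (integrable_parts k.+1 j) (integrable_parts k j.+1).
  by congr integrable; apply/funext => x.
Qed.

(** The order [j] is kept general because each step of the induction raises it by one. *)
Lemma iterated_parts n j :
  \int[mu]_x (derive1n n G x * derive1n j phi x) =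
  (-1) ^+ n * \int[mu]_x (G x * derive1n (n + j) phi x).
Proof.
elim: n j => [|n IH] j; first by rewrite expr0 mul1r.
by rewrite Rintegral_parts IH exprS mulN1r mulNr addSnnS.
Qed.

End parts.

Lemma is_nth_distr_deriv_derive1n (G : R -> R) n :
  (forall k (x : R), derivable (derive1n k G) x 1) ->
  (forall k, exists2 C : R, 0 <= C &
    forall x, `|derive1n k G x| <= C * (1 + x ^+ 2)) ->
  is_nth_distr_deriv n (derive1n n G) G.
Proof.
move=> dG bG phi sphi; split.
  exact: (integrable_parts dG bG sphi n 0).
by have := iterated_parts dG bG sphi n 0; rewrite addn0.
Qed.

End distributional_derivative.

(** * Continuity of translation in $L^1$ for functions of bounded support *)

Section L1_translation.
Context {R : realType}.
Local Notation mu := (@lebesgue_measure R).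

(** The trapezoid equal to $1$ on $[-N,N]$, linear on each side, and $0$ beyond distance $N+1$. *)
Definition cutoff (N x : R) : R := Num.max 0 (Num.min 1 (N + 1 - `|x|)).

Lemma cutoff_itv (N x : R) : 0 <= cutoff N x <= 1.
Proof. by rewrite /cutoff le_max lexx/= ge_max ler01/= ge_min lexx. Qed.

Lemma cutoff1 (N x : R) : `|x| <= N -> cutoff N x = 1.
Proof. by move=> xN; rewrite /cutoff min_l ?max_r//; lra. Qed.

Lemma cutoff0 (N x : R) : N + 1 < `|x| -> cutoff N x = 0.
Proof. by move=> xN; rewrite /cutoff max_l// ge_min; apply/orP; right; lra. Qed.

Lemma continuous_cutoff (N : R) : continuous (cutoff N).
Proof.
move=> x.
apply: (@continuous_max R R (cst 0) (cst 1 \min (fun t => N + 1 - `|t|))).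
  exact: cvg_cst.
apply: (@continuous_min R R (cst 1) (fun t => N + 1 - `|t|)); first exact: cvg_cst.
by apply: cvgB; [exact: cvg_cst|exact: norm_continuous].
Qed.

(** The extreme value theorem bounds [h] by some $K$; for $|s|<1$ the difference is then dominated
    by $2K$ on $[-N-1,N+1]$, and continuity under the integral applies at $s=0$. *)
Lemma translation_cvg_continuous (h : R -> R) (N e : R) : 0 <= N -> 0 < e ->
  continuous h -> (forall x, N < `|x| -> h x = 0) ->
  exists2 r : R, 0 < r & forall s, `|s| < r ->
    (\int[mu]_x `|h (x + s) - h x|%:E <= e%:E)%E.
Proof.
move=> N0 e0 ch h0.
have [K K0 hK] : exists2 K : R, 0 <= K & forall x, `|h x| <= K.
  have NN : - N <= N by lra.
  have cn : {within `[- N, N], continuous (fun x => `|h x|)}.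
    by apply: continuous_subspaceT => x; apply: cvg_norm; exact: ch.
  have [c _ Hc] := EVT_max NN cn.
  exists `|h c| => // x; have [xN|xN] := leP `|x| N; last by rewrite h0// normr0.
  by apply: Hc; rewrite in_itv/= -ler_norml.
pose B : set R := `[- (N + 1), N + 1]%classic.
have muB : (mu B < +oo)%E.
  by rewrite lebesgue_measure_itv/=; case: ifP; rewrite ?ltry// -EFinD ltry.
pose g (x : R) := 2 * K * \1_B x.
have ig : mu.-integrable setT (EFin \o g).
  apply: integrable_EFinZl; apply/integrableP; split.
    apply/measurable_EFinP; apply: measurable_indic; exact: measurable_itv.
  under eq_integral do rewrite /= ger0_norm//.
  by rewrite integral_indic ?setIT//; exact: measurable_itv.
pose f (s x : R) : R := `|h (x + s) - h x|.
have cf s : continuous (f s).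
  move=> x; apply: cvg_norm; apply: cvgB; last exact: ch.
  apply: (@continuous_comp _ _ _ (fun v : R => v + s) h); last exact: ch.
  by apply: cvgD; [exact: cvg_id|exact: cvg_cst].
have fg (s x : R) : `]-1, 1[%classic s -> `|f s x| <= g x.
  rewrite /= in_itv/= => /andP[s1 s2]; rewrite /f normr_id /g indicE.
  have [_|] := boolP (x \in B); last first.
    rewrite notin_setE /B/= in_itv/= -ler_norml => /negP; rewrite -ltNge => xN.
    rewrite h0 ?h0 ?subrr ?normr0 ?mulr0//; first by lra.
    have := ler_normB (x + s) s; rewrite addrK.
    have : `|s| < 1 by rewrite ltr_norml s1.
    lra.
  rewrite mulr1; apply: le_trans (ler_normB _ _) _.
  by have := hK (x + s); have := hK x; lra.
have ifs (s : R) : `]-1, 1[%classic s -> mu.-integrable setT (EFin \o f s).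
  move=> s1; apply: (le_integrable measurableT _ _ ig).
    by apply/measurable_EFinP; exact: continuous_measurable_fun.
  by move=> x _ /=; rewrite lee_fin (le_trans (fg s x s1))// ler_norm.
have c0 : {in `]-1, 1[%classic, continuous (fun s => \int[mu]_x f s x)}.
  apply: (continuity_under_integral measurableT ifs _ ig).
  - apply: aeW => x _ s _; apply: cvg_norm; apply: cvgB; last exact: cvg_cst.
    apply: (@continuous_comp _ _ _ (fun v : R => x + v) h); last exact: ch.
    by apply: cvgD; [exact: cvg_cst|exact: cvg_id].
  - by move=> s s1; apply: aeW => x _; exact: fg.
have /c0 : (0 : R) \in (`]-1, 1[%classic : set R).
  by rewrite inE/= in_itv/=; lra.
rewrite /continuous_at (_ : \int[mu]_x f 0 x = 0); last first.
  rewrite /f; under eq_Rintegral do rewrite addr0 subrr normr0.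
  by rewrite Rintegral_cst// mul0r.
move=> /cvgr0Pnorm_le/(_ _ e0)/nbhs_ballP[r /= r0 Hr].
exists (Num.min r 1); first by rewrite lt_min r0 ltr01.
move=> s; rewrite lt_min => /andP[sr s1].
have sI : `]-1, 1[%classic s by rewrite /= in_itv/= -ltr_norml.
have := Hr s; rewrite /ball/= sub0r normrN => /(_ sr) Hs.
rewrite -[leLHS]fineK; last exact: (integrable_fin_num measurableT (ifs s sI)).
by rewrite lee_fin (le_trans (ler_norm _) Hs).
Qed.

(* [f] is approximated by a continuous [g] on [[-N-1, N+1]]; since [f] vanishes
   where the cutoff is not [1], multiplying [g] by the cutoff keeps the error and
   makes [g] continuous with compact support. *)
Lemma translation_cvg_L1 (f : R -> R) (N e : R) : 0 <= N -> 0 < e ->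
  mu.-integrable setT (EFin \o f) -> (forall x, N < `|x| -> f x = 0) ->
  exists2 r : R, 0 < r & forall s, `|s| < r ->
    (\int[mu]_x `|f (x + s) - f x|%:E <= e%:E)%E.
Proof.
move=> N0 e0 fi f0.
have mf : measurable_fun setT f by case/integrableP: fi => /measurable_EFinP.
pose E : set R := `[- (N + 1), N + 1]%classic.
have mE : measurable E by exact: measurable_itv.
have muE : (mu E < +oo)%E.
  by rewrite lebesgue_measure_itv/=; case: ifP; rewrite ?ltry// -EFinD ltry.
have fiE : mu.-integrable E (EFin \o f) by apply: integrableS fi.
have [g_ [cg _]] := approximation_continuous_integrable mE muE fiE.
have e3 : 0 < e / 3 by rewrite divr_gt0.
move=> /fine_cvgP[fin /cvgr0Pnorm_le/(_ _ e3) near0].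
have [n [/= finn gn]] := filter_ex (filterI fin near0).
set X := (\int[mu]_(z in E) _)%E in finn gn.
have {}gn : (X <= (e / 3)%:E)%E.
  by rewrite -(fineK finn) lee_fin (le_trans (ler_norm _) gn).
pose h x := g_ n x * cutoff N x.
have ch : continuous h.
  by move=> x; apply: cvgM; [exact: cg|exact: continuous_cutoff].
have h0 x : N + 1 < `|x| -> h x = 0 by move=> xN; rewrite /h cutoff0// mulr0.
have N10 : 0 <= N + 1 by lra.
have [r r0 hr] := translation_cvg_continuous N10 e3 ch h0.
exists r => // s sr.
have mh := continuous_measurable_fun ch.
pose D (x : R) : \bar R := `|f x - h x|%:E.
have mD : measurable_fun setT D.
  apply/measurable_EFinP; apply: measurableT_comp => //.
  exact: measurable_funB.
have D0 x : (0 <= D x)%E by rewrite lee_fin.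
have Dle : (\int[mu]_x D x <= (e / 3)%:E)%E.
  apply: le_trans gn; rewrite /X [leRHS]integral_mkcond; apply: ge0_le_integral => //.
  - apply/(measurable_restrictT _ _).1 => //.
    apply/measurable_EFinP; apply: measurableT_comp => //.
    apply: measurable_funB; first exact: measurable_funTS.
    by apply: measurable_funTS; exact: continuous_measurable_fun.
  (* For $|x|\le N$ the cutoff is $1$; for $N<|x|\le N+1$, [f] vanishes and the cutoff only shrinks
     the approximant; farther out both sides vanish. *)
  - move=> x _; rewrite patchE /D /h; have [xN|xN] := leP `|x| N.
      by rewrite ifT ?cutoff1 ?mulr1// inE /E/= in_itv/= -ler_norml; lra.
    case: ifPn => [_|]; last first.
      rewrite notin_setE /E/= in_itv/= -ler_norml => /negP; rewrite -ltNge => xN1.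
      by rewrite cutoff0// mulr0 f0// subrr normr0.
    rewrite f0// !sub0r /= !normrN normrM lee_fin ler_piMr//.
    by have /andP[c0 c1] := cutoff_itv N x; rewrite ger0_norm.
have ms : measurable_fun setT (fun x : R => x + s) by exact: measurable_funD.
have mDs : measurable_fun setT (fun x : R => D (x + s)).
  exact: (measurableT_comp mD ms).
have mhs : measurable_fun setT (fun x : R => `|h (x + s) - h x|%:E).
  apply/measurable_EFinP; apply: measurableT_comp => //.
  by apply: measurable_funB => //; exact: (measurableT_comp mh ms).
have le3 : (\int[mu]_x `|f (x + s) - f x|%:E <=
    \int[mu]_x (D (x + s)%R + `|h (x + s) - h x|%:E + D x))%E.
  apply: ge0_le_integral => //.
  - apply/measurable_EFinP; apply: measurableT_comp => //.
    by apply: measurable_funB => //; exact: (measurableT_comp mf ms).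
  - by apply: emeasurable_funD => //; exact: emeasurable_funD.
  - move=> x _; rewrite /D -!EFinD lee_fin.
    rewrite (_ : f (x + s) - f x =
      (f (x + s) - h (x + s)) + (h (x + s) - h x) - (f x - h x)); last by ring.
    by apply: le_trans (ler_normB _ _) _; rewrite lerD2r ler_normD.
apply: le_trans le3 _.
rewrite ge0_integralD//; last 2 first.
- by move=> x _; rewrite adde_ge0.
- exact: emeasurable_funD.
rewrite ge0_integralD// ge0_integral_translation//.
rewrite (_ : e%:E = ((e / 3)%:E + (e / 3)%:E + (e / 3)%:E)%E).
  by apply: leeD => //; apply: leeD => //; exact: hr.
by rewrite -!EFinD; congr EFin; field.
Qed.

End L1_translation.

(** * Continuity of translation in $L^p$ by truncation *)

Section Lp_translation.
Context {R : realType}.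
Local Notation mu := (@lebesgue_measure R).
Variable (p : R).
Hypothesis p1 : 1 <= p.

Let p0 : 0 < p. Proof. exact: lt_le_trans p1. Qed.

Lemma powR_le (a b : R) : 0 <= a -> a <= b -> a `^ p <= b `^ p.
Proof.
move=> a0 ab; apply: ge0_ler_powR => //; first exact: ltW.
by rewrite nnegrE (le_trans a0).
Qed.

(** The sum is at most three times the maximum, and the power of the maximum is one of the three
    summands. *)
Lemma powR_sum3 (a b c : R) : 0 <= a -> 0 <= b -> 0 <= c ->
  (a + b + c) `^ p <= 3 `^ p * (a `^ p + b `^ p + c `^ p).
Proof.
move=> a0 b0 c0; have pg x := powR_ge0 x p.
pose m := Num.max a (Num.max b c).
have m0 : 0 <= m by rewrite le_max a0.
have ma : a <= m by rewrite le_max lexx.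
have mb : b <= m by rewrite !le_max lexx !orbT.
have mc : c <= m by rewrite !le_max lexx !orbT.
apply: (@le_trans _ _ ((3 * m) `^ p)).
  by apply: powR_le; [rewrite !addr_ge0|lra].
rewrite powRM// ler_wpM2l//.
have pa := pg a; have pb := pg b; have pc := pg c.
rewrite /m maxEle; case: ifP => _; last by lra.
rewrite maxEle; case: ifP => _; lra.
Qed.

Lemma measurable_normr_powR (f : R -> R) : measurable_fun setT f ->
  measurable_fun setT (fun x => (`|f x| `^ p)%:E).
Proof.
move=> mf; apply/measurable_EFinP.
apply: (measurableT_comp (measurable_powR p)).
exact: measurableT_comp.
Qed.

Lemma measurable_translation (f : R -> R) (s : R) : measurable_fun setT f ->
  measurable_fun setT (fun x : R => f (x + s)).
Proof.
move=> mf; apply: (measurableT_comp mf); exact: measurable_funD.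
Qed.

Lemma integral_translation_norm_powR (f : R -> R) (s : R) : measurable_fun setT f ->
  (\int[mu]_x (`|f (x + s)| `^ p)%:E = \int[mu]_x (`|f x| `^ p)%:E)%E.
Proof.
move=> mf; apply: (@ge0_integral_translation R s (fun x => (`|f x| `^ p)%:E)).
  exact: measurable_normr_powR.
by move=> x; rewrite lee_fin powR_ge0.
Qed.

Lemma Lp_sum3 (f a b c : R -> R) :
  measurable_fun setT f -> measurable_fun setT a ->
  measurable_fun setT b -> measurable_fun setT c ->
  (forall x, `|f x| <= `|a x| + `|b x| + `|c x|) ->
  (\int[mu]_x (`|f x| `^ p)%:E <=
     (3 `^ p)%:E * (\int[mu]_x (`|a x| `^ p)%:E + \int[mu]_x (`|b x| `^ p)%:E
       + \int[mu]_x (`|c x| `^ p)%:E))%E.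
Proof.
move=> mf ma mb mc fabc.
have pg (x : R) : (0 <= (x `^ p)%:E)%E by rewrite lee_fin powR_ge0.
have m f' := @measurable_normr_powR f'.
rewrite -ge0_integralD//; [|exact: m..].
rewrite -ge0_integralD//; last 3 first.
- by move=> x _; rewrite adde_ge0.
- by apply: emeasurable_funD; exact: m.
- exact: m.
rewrite -ge0_integralZl_EFin ?powR_ge0//; last 2 first.
- by move=> x _; rewrite !adde_ge0.
- by apply: emeasurable_funD; [apply: emeasurable_funD|]; exact: m.
apply: ge0_le_integral => //; first exact: m.
- apply: measurable_funeM; apply: emeasurable_funD; last exact: m.
  by apply: emeasurable_funD; exact: m.
- move=> x _; rewrite -!EFinD -EFinM lee_fin.
  by apply: le_trans (powR_le _ (fabc x)) (powR_sum3 _ _ _).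
Qed.

(** Argument and value are both truncated: bounded support feeds the $L^1$ result, bounded values
    convert it to $L^p$. *)
Definition trunc_set (F : R -> R) (N : R) : set R :=
  `[- N, N]%classic `&` (F @^-1` `[- N, N]%classic).

Definition trunc (F : R -> R) (N x : R) : R := F x * \1_(trunc_set F N) x.

Lemma measurable_trunc_set (F : R -> R) (N : R) : measurable_fun setT F ->
  measurable (trunc_set F N).
Proof.
move=> mF; apply: measurableI; first exact: measurable_itv.
by rewrite -[X in measurable X]setTI; apply: mF => //; exact: measurable_itv.
Qed.

Lemma measurable_trunc (F : R -> R) (N : R) : measurable_fun setT F ->
  measurable_fun setT (trunc F N).
Proof.
move=> mF; apply: measurable_funM => //; apply: measurable_indic.
exact: measurable_trunc_set.
Qed.

Lemma trunc_le (F : R -> R) (N x : R) : 0 <= N -> `|trunc F N x| <= N.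
Proof.
move=> N0; rewrite /trunc indicE; have [|_] := boolP (x \in trunc_set F N).
  by rewrite inE => -[_ /=]; rewrite in_itv/= -ler_norml mulr1.
by rewrite mulr0 normr0.
Qed.

Lemma trunc_eq0 (F : R -> R) (N x : R) : N < `|x| -> trunc F N x = 0.
Proof.
move=> xN; rewrite /trunc indicE; have [|_] := boolP (x \in trunc_set F N).
  by rewrite inE => -[/=]; rewrite in_itv/= -ler_norml leNgt xN.
by rewrite mulr0.
Qed.

Lemma inLp_integrable_powR (F : R -> R) : inLp p F ->
  mu.-integrable setT (EFin \o (fun x => `|F x| `^ p)).
Proof.
move=> [mF iF]; apply/integrableP; split; first exact: measurable_normr_powR.
by under eq_integral do rewrite /= ger0_norm ?powR_ge0//.
Qed.

(** Dominated convergence with majorant $|F|^p$: at each point the truncation equals [F] once [n]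
    exceeds $|x|$ and $|F(x)|$. *)
Lemma trunc_cvg_Lp (F : R -> R) (e : R) : inLp p F -> 0 < e ->
  exists2 N : R, 0 <= N &
    (\int[mu]_x (`|F x - trunc F N x| `^ p)%:E <= e%:E)%E.
Proof.
move=> LF e0; have iFp := inLp_integrable_powR LF; have [mF _] := LF.
pose f_ (n : nat) x := (`|F x - trunc F n%:R x| `^ p)%:E.
have mf_ n : measurable_fun setT (f_ n).
  by apply: measurable_normr_powR; apply: measurable_funB => //; exact: measurable_trunc.
have cf : {ae mu, forall x, setT x -> f_ ^~ x @ \oo --> (cst 0%E : R -> \bar R) x}.
  apply: aeW => x _; apply: cvg_near_cst; near=> n.
  have nx : `|x| <= n%:R by near: n; exact: nbhs_infty_ger.
  have nF : `|F x| <= n%:R by near: n; exact: nbhs_infty_ger.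
  rewrite /f_ /trunc indicE mem_set; first by rewrite mulr1 subrr normr0 powR0// gt_eqF.
  by split; rewrite /= in_itv/= -ler_norml.
have bf : {ae mu, forall x n, setT x ->
    (`|f_ n x| <= (`|F x| `^ p)%:E)%E}.
  apply: aeW => x n _; rewrite /f_ /= ger0_norm ?powR_ge0// lee_fin powR_le//.
  rewrite /trunc indicE; case: (_ \in _); rewrite ?mulr1 ?mulr0 ?subr0//.
  by rewrite subrr normr0.
have [_ _] := @dominated_convergence _ _ R mu setT measurableT f_ (cst 0%E)
  _ mf_ (measurable_cst _) cf iFp bf.
rewrite integral0 => /fine_cvgP[fin /cvgr0Pnorm_le/(_ _ e0) near0].
have [n [/= finn gn]] := filter_ex (filterI fin near0).
exists n%:R => //; rewrite -[leLHS](fineK finn) lee_fin.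
exact: le_trans (ler_norm _) gn.
Unshelve. all: end_near. Qed.

(** [F] is replaced by a truncation [G] at both places, with equal errors by translation invariance.
    For [G], $|G(x+s)-G(x)|^p\le(2N)^{p-1}|G(x+s)-G(x)|$ reduces to $L^1$. *)
Lemma translation_cvg_Lp (F : R -> R) (e : R) : inLp p F -> 0 < e ->
  exists2 r : R, 0 < r & forall s, `|s| < r ->
    (\int[mu]_x (`|F (x + s) - F x| `^ p)%:E <= e%:E)%E.
Proof.
move=> LF e0; have [mF iF] := LF.
have p30 : 0 < 3 `^ p :> R by rewrite powR_gt0.
(* Three errors [e1], multiplied by the constant $3^p$ of [Lp_sum3], add up to [e]. *)
pose e1 := e / 3 `^ p / 3.
have e10 : 0 < e1 by rewrite !divr_gt0.
have [N N0 HN] := trunc_cvg_Lp LF e10.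
pose G := trunc F N; have mG : measurable_fun setT G by exact: measurable_trunc.
(* Adding $1$ keeps the divisor positive when $N=0$. *)
pose k := (2 * N) `^ (p - 1) + 1.
have k0 : 0 < k by rewrite ltr_wpDl// powR_ge0.
have iG : mu.-integrable setT (EFin \o G).
  pose J : set R := `[- N, N]%classic.
  have iA : mu.-integrable setT (EFin \o (\1_J : R -> R)).
    apply/integrableP; split.
      by apply/measurable_EFinP; apply: measurable_indic; exact: measurable_itv.
    under eq_integral do rewrite /= ger0_norm//.
    have muJ : (mu J < +oo)%E.
      by rewrite lebesgue_measure_itv/=; case: ifP; rewrite ?ltry// -EFinD ltry.
    by rewrite integral_indic ?setIT//; exact: measurable_itv.
  apply: (le_integrable measurableT _ _ (integrable_EFinZl N iA)).
    exact/measurable_EFinP.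
  move=> x _ /=; rewrite lee_fin indicE.
  have [xN|xN] := leP `|x| N; last by rewrite /G trunc_eq0// normr0.
  have Jx : J x by rewrite /J/= in_itv/= -ler_norml.
  by rewrite mem_set// mulr1 (ger0_norm N0) trunc_le.
have [r r0 Hr] := translation_cvg_L1 N0 (divr_gt0 e10 k0) iG
  (fun x => @trunc_eq0 F N x).
exists r => // s sr.
have msh f := @measurable_translation f s.
have mFG : measurable_fun setT (fun x => F x - G x) by exact: measurable_funB.
apply: le_trans (@Lp_sum3 _ (fun x => F (x + s) - G (x + s))
  (fun x => G (x + s) - G x) (fun x => F x - G x) _ _ _ _ _) _.
- by apply: measurable_funB => //; exact: msh.
- exact: (msh (fun x => F x - G x)).
- by apply: measurable_funB => //; exact: msh.
- by [].
- move=> x; rewrite (_ : F (x + s) - F x =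
    (F (x + s) - G (x + s)) + (G (x + s) - G x) - (F x - G x)); last by ring.
  by apply: le_trans (ler_normB _ _) _; rewrite lerD2r ler_normD.
rewrite (integral_translation_norm_powR s mFG).
have HG : (\int[mu]_x (`|G (x + s) - G x| `^ p)%:E <= e1%:E)%E.
  apply: (@le_trans _ _ (\int[mu]_x (k%:E * `|G (x + s) - G x|%:E))%E).
    apply: ge0_le_integral => //.
    - by apply: measurable_normr_powR; apply: measurable_funB => //; exact: msh.
    - apply: measurable_funeM; apply/measurable_EFinP; apply: measurableT_comp => //.
      by apply: measurable_funB => //; exact: msh.
    - move=> x _; rewrite -EFinM lee_fin -mulr_powRB1// mulrC ler_wpM2r//.
      rewrite ler_wpDr//; apply: ge0_ler_powR; rewrite ?nnegrE//.
      + by rewrite subr_ge0.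
      + by rewrite mulr_ge0.
      + apply: le_trans (ler_normB _ _) _.
        by have := @trunc_le F N x N0; have := @trunc_le F N (x + s) N0; rewrite /G; lra.
  rewrite ge0_integralZl_EFin//; last 2 first.
  - apply/measurable_EFinP; apply: measurableT_comp => //.
    by apply: measurable_funB => //; exact: msh.
  - exact: ltW.
  rewrite (_ : e1 = k * (e1 / k)); last by rewrite mulrCA divff ?mulr1// gt_eqF.
  by rewrite EFinM lee_wpmul2l ?lee_fin ?(ltW k0)//; exact: Hr.
apply: (@le_trans _ _ ((3 `^ p)%:E * (e1%:E + e1%:E + e1%:E))%E).
  by rewrite lee_wpmul2l ?lee_fin ?(ltW p30)//; apply: leeD => //; exact: leeD.
rewrite -!EFinD -EFinM lee_fin le_eqVlt; apply/orP; left; apply/eqP.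
by rewrite /e1; field; rewrite gt_eqF.
Qed.

End Lp_translation.

(** * Contraction and convergence of Poisson integrals in $L^p$ *)

Section Lp_poisson.
Context {R : realType}.
Local Notation mu := (@lebesgue_measure R).
Variable (p : R).
Hypothesis p1 : 1 <= p.
Implicit Types (F : R -> R) (x y s : R).

Let p0 : 0 < p. Proof. exact: lt_le_trans p1. Qed.

(** Pointwise $|F|/(1+x^2)\le1/(1+x^2)+|F|^p$, by comparing $|F|$ with $1$. *)
Lemma inLp_weighted_integrable F : inLp p F -> weighted_integrable F.
Proof.
move=> LF; have iF := inLp_integrable_powR LF; have [mF _] := LF; split => //.
have i2 : mu.-integrable setT
    (EFin \o (fun x : R => (1 + x ^+ 2)^-1 + `|F x| `^ p)).
  have := @integrableD _ _ R mu setT measurableT _ _ integrable_inv_oneDsqr iF.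
  by congr integrable; apply/funext => x.
apply: (le_integrable measurableT _ _ i2).
  apply/measurable_EFinP; apply: measurable_funM; first exact: measurableT_comp.
  have [/measurable_EFinP //] := integrableP _ _ _ (@integrable_inv_oneDsqr R).
move=> x _ /=; rewrite lee_fin.
have w0 : 0 < 1 + x ^+ 2 by rewrite ltr_wpDr ?sqr_ge0.
have w1 : (1 + x ^+ 2)^-1 <= 1 by rewrite invf_le1// lerDl sqr_ge0.
have wi : 0 <= (1 + x ^+ 2)^-1 by rewrite invr_ge0 ltW.
have F0 := powR_ge0 `|F x| p.
rewrite [leLHS]ger0_norm ?mulr_ge0// [leRHS]ger0_norm ?addr_ge0//.
have [F1|F1] := leP `|F x| 1.
  by apply: le_trans (ler_wpM2r wi F1) _; rewrite mul1r lerDl.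
apply: le_trans (ler_wpM2l (normr_ge0 _) w1) _; rewrite mulr1.
apply: (@le_trans _ _ (`|F x| `^ p)); last by rewrite lerDr.
by rewrite -{1}[`|F x|]powRr1// ler_powR// ltW.
Qed.

Lemma integrable_poissonU F x y : weighted_integrable F -> 0 < y ->
  mu.-integrable setT (EFin \o (fun xi => F xi * poisson y (x - xi))).
Proof.
move=> wF y0.
have := integrable_EFinZl (- pi^-1)
  (integrable_cint x wF (isT : (false < 1)%N) y0).
congr integrable; apply/funext => xi /=; congr EFin.
by rewrite -poissonN opprB poissonE//= mulrCA.
Qed.

Lemma measurable_poisson_shift x y : 0 < y ->
  measurable_fun setT (fun xi : R => poisson y (x - xi)).
Proof.
move=> y0; apply: (measurableT_comp (measurable_poisson y0)).
exact: measurable_funB.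
Qed.

Lemma integral_poisson_shift x y : 0 < y ->
  (\int[mu]_xi (poisson y (x - xi))%:E = 1)%E.
Proof.
move=> y0; rewrite -(integral_poisson y0).
rewrite -(@ge0_integral_translation R (- x) (fun s => (poisson y s)%:E)).
- by apply: eq_integral => xi _; rewrite -poissonN opprB.
- by apply/measurable_EFinP; exact: measurable_poisson.
- by move=> s; rewrite lee_fin ltW// poisson_gt0.
Qed.

(** As the kernel has mass $1$, the constant [c] goes under the integral; Jensen's inequality and
    the substitution $\xi=s+x$ conclude. *)
Lemma poissonU_sub_powR_le F x y (c : R) : weighted_integrable F -> 0 < y ->
  ((`|poissonU F y x - c| `^ p)%:E <=
   \int[mu]_s (poisson y s * `|F (s + x) - c| `^ p)%:E)%E.
Proof.
move=> wF y0; have [mF _] := wF.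
pose w (xi : R) := poisson y (x - xi).
have w0 xi : 0 <= w xi by rewrite ltW// poisson_gt0.
have mw : measurable_fun setT w by exact: measurable_poisson_shift.
have w1 : (\int[mu]_xi (w xi)%:E = 1)%E by exact: integral_poisson_shift.
have iw : mu.-integrable setT (EFin \o w).
  apply/integrableP; split; first exact/measurable_EFinP.
  by under eq_integral do rewrite /= ger0_norm//; rewrite w1 ltry.
have iFw : mu.-integrable setT (EFin \o (fun xi => F xi * w xi)).
  exact: integrable_poissonU.
have icw := integrable_EFinZl c iw.
have UE : poissonU F y x - c = \int[mu]_xi (F xi * w xi - c * w xi).
  rewrite RintegralB// RintegralZl//; congr (_ - _).
  by rewrite [\int[mu]_x w x]/Rintegral w1 /= mulr1.
have iD : mu.-integrable setT (EFin \o (fun xi => F xi * w xi - c * w xi)).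
  have := @integrableB _ _ R mu setT measurableT _ _ iFw icw.
  by congr integrable; apply/funext => xi.
have iN : mu.-integrable setT (fun xi => (w xi * `|F xi - c|)%:E).
  have := integrable_abse iD; congr integrable; apply/funext => xi /=.
  by rewrite -mulrBl normrM (ger0_norm (w0 xi)) mulrC.
have mFc : measurable_fun setT (fun xi => `|F xi - c|).
  by apply: measurableT_comp => //; exact: measurable_funB.
have U_le : `|poissonU F y x - c| <= \int[mu]_xi (w xi * `|F xi - c|).
  rewrite UE; apply: le_trans (le_normr_Rintegral _ iD) _ => //.
  rewrite le_eqVlt; apply/orP; left; apply/eqP; apply: eq_Rintegral => xi _.
  by rewrite -mulrBl normrM (ger0_norm (w0 xi)) mulrC.
apply: (@le_trans _ _ (((\int[mu]_xi (w xi * `|F xi - c|)) `^ p)%:E)).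
  by rewrite lee_fin powR_le.
have J := @powR_jensen R _ _ mu p w (fun xi => `|F xi - c|) p1 mw mFc w0
  (fun=> normr_ge0 _) w1 iN.
apply: (le_trans J).
rewrite -(@ge0_integral_translation R x (fun xi => (w xi * `|F xi - c| `^ p)%:E)).
- rewrite le_eqVlt; apply/orP; left; apply/eqP; apply: eq_integral => s _.
  by rewrite /w opprD addrCA subrr addr0 poissonN.
- apply/measurable_EFinP; apply: measurable_funM => //.
  exact: (measurableT_comp (measurable_powR p) mFc).
- by move=> xi; rewrite lee_fin mulr_ge0// powR_ge0.
Qed.

Lemma continuous_poissonU F y : weighted_integrable F -> 0 < y ->
  continuous (poissonU F y).
Proof.
move=> wF y0 x; apply: differentiable_continuous; apply/derivable1_diffP.
by have := @derivable_derive1n_poissonU R 0 F x y wF y0.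
Qed.

Lemma Lp_poissonU_sub_le F y (k : R) : inLp p F -> 0 < y ->
  (\int[mu]_x (`|poissonU F y x - k * F x| `^ p)%:E <=
   \int[mu]_s ((poisson y s)%:E * \int[mu]_x (`|F (x + s)%R - k * F x| `^ p)%:E))%E.
Proof.
move=> LF y0; have wF := inLp_weighted_integrable LF; have [mF _] := LF.
pose f (z : measurableTypeR R * measurableTypeR R) : \bar R :=
  (poisson y z.2 * `|F (z.2 + z.1) - k * F z.1| `^ p)%:E.
have f0 z : (0 <= f z)%E.
  by rewrite lee_fin mulr_ge0 ?powR_ge0// ltW// poisson_gt0.
have mf : measurable_fun setT f.
  apply/measurable_EFinP; apply: measurable_funM.
    exact: (measurableT_comp (measurable_poisson y0) measurable_snd).
  apply: (measurableT_comp (measurable_powR p)); apply: measurableT_comp => //.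
  apply: measurable_funB.
    by apply: (measurableT_comp mF); apply: measurable_funD.
  apply: measurable_funM => //; exact: (measurableT_comp mF measurable_fst).
apply: (@le_trans _ _ (\int[mu]_x \int[mu]_s f (x, s))%E).
  apply: ge0_le_integral => //.
  - apply: measurable_normr_powR => //; apply: measurable_funB.
      by apply: continuous_measurable_fun; exact: continuous_poissonU.
    exact: measurable_funM.
  - exact: (measurable_fun_fubini_tonelli_F (m2 := mu) f mf f0).
  - by move=> x _; exact: poissonU_sub_powR_le.
rewrite (fubini_tonelli (m1 := mu) (m2 := mu) f mf f0).
rewrite le_eqVlt; apply/orP; left; apply/eqP; apply: eq_integral => s _.
rewrite /f/=; under eq_integral do rewrite EFinM.
rewrite ge0_integralZl_EFin//.
- by congr (_ * _)%E; apply: eq_integral => x _;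
  rewrite (addrC s).
- apply: measurable_normr_powR => //; apply: measurable_funB.
    by apply: (measurableT_comp mF); exact: measurable_funD.
  exact: measurable_funM.
- exact/ltW/poisson_gt0.
Qed.

(** For $k=0$ the inner integral does not depend on [s], so only the mass $1$ of the kernel
    remains. *)
Lemma Lp_poissonU_le F y : inLp p F -> 0 < y ->
  (\int[mu]_x (`|poissonU F y x| `^ p)%:E <= \int[mu]_x (`|F x| `^ p)%:E)%E.
Proof.
move=> LF y0; have [mF iF] := LF.
have := Lp_poissonU_sub_le 0 LF y0.
under eq_integral do rewrite mul0r subr0.
move=> /le_trans; apply.
set I := (\int[mu]_x (`|F x| `^ p)%:E)%E.
rewrite (_ : (\int[mu]_s _ = \int[mu]_s (I * (poisson y s)%:E))%E); last first.
  apply: eq_integral => s _; rewrite muleC; congr (_ * _)%E.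
  under eq_integral do rewrite mul0r subr0.
  exact: integral_translation_norm_powR.
have I0 : (0 <= I)%E by apply: integral_ge0 => x _; rewrite lee_fin powR_ge0.
have IE : I = (fine I)%:E by rewrite fineK// ge0_fin_numE.
rewrite IE ge0_integralZl_EFin ?integral_poisson ?mule1//.
- by move=> s _; rewrite lee_fin ltW// poisson_gt0.
- by apply/measurable_EFinP; exact: measurable_poisson.
- by rewrite fine_ge0.
Qed.

(** Here $1/(s^2+y^2)\le1/s^2\le(1+r^{-2})/(1+s^2)$. The kernel at height $1$ is thus an integrable
    majorant of the tail, with a factor of order [y]. *)
Lemma poisson_tail_le (r s y : R) : 0 < r -> 0 < y -> r <= `|s| ->
  poisson y s <= y * (1 + r ^- 2) * poisson 1 s.
Proof.
move=> r0 y0 rs; rewrite /poisson expr1n mul1r -mulrA ler_wpM2l ?(ltW y0)//.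
rewrite ![(pi * _)^-1]invfM mulrCA ler_wpM2l ?invr_ge0 ?pi_ge0//.
have s2 : r ^+ 2 <= s ^+ 2.
  by rewrite -[s ^+ 2]real_normK ?num_real// ler_sqr ?nnegrE// ltW.
have s0 : 0 < s ^+ 2 by apply: lt_le_trans s2; rewrite exprn_gt0.
apply: (@le_trans _ _ (s ^+ 2)^-1).
  by rewrite lef_pV2 ?posrE ?sqrD_sqr_gt0// lerDl sqr_ge0.
rewrite ler_pdivlMr ?ltr_wpDl ?sqr_ge0// ler_pdivrMl// mulrDr mulr1 lerD2l.
by rewrite ler_pdivlMr ?exprn_gt0// mul1r.
Qed.

(** For $|s|<r$ the translation error [om s] is at most $e/2$; for larger $|s|$ it is at most [M],
    and the tail bound makes its contribution at most $cy$. *)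
Lemma Lp_poissonU_cvg F (e : R) : inLp p F -> 0 < e ->
  \forall y \near 0^'+,
    (\int[mu]_x (`|poissonU F y x - F x| `^ p)%:E <= e%:E)%E.
Proof.
move=> LF e0; have [mF iF] := LF.
have e20 : 0 < e / 2 by rewrite divr_gt0.
have [r r0 Hr] := translation_cvg_Lp p1 LF e20.
pose om (s : R) := (\int[mu]_x (`|F (x + s)%R - 1 * F x| `^ p)%:E)%E.
have om0 s : (0 <= om s)%E by apply: integral_ge0 => x _; rewrite lee_fin powR_ge0.
have [M M0 HM] : exists2 M : R, 0 <= M & forall s, (om s <= M%:E)%E.
  set I := (\int[mu]_x (`|F x| `^ p)%:E)%E in iF.
  have I0 : (0 <= I)%E by apply: integral_ge0 => x _; rewrite lee_fin powR_ge0.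
  have IE : I = (fine I)%:E by rewrite fineK// ge0_fin_numE.
  exists (3 `^ p * (fine I + fine I + 0)).
    by rewrite mulr_ge0 ?powR_ge0// !addr_ge0// fine_ge0.
  move=> s; apply: le_trans (@Lp_sum3 _ p p1 _ (fun x => F (x + s)) F (cst 0) _ _ _ _ _) _.
  - apply: measurable_funB; last exact: measurable_funM.
    exact: measurable_translation.
  - exact: measurable_translation.
  - by [].
  - exact: measurable_cst.
  - by move=> x; rewrite mul1r normr0 addr0 ler_normB.
  rewrite integral_translation_norm_powR// -/I.
  under [X in (_ + X)%E]eq_integral do rewrite normr0 powR0 ?gt_eqF//.
  by rewrite integral0 IE -!EFinD -EFinM.
pose c := M * (1 + r ^- 2).
have c0 : 0 <= c by rewrite mulr_ge0// addr_ge0// invr_ge0 exprn_ge0 ?ltW.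
near=> y.
have y0 : 0 < y by near: y; exact: nbhs_right_gt.
have yc : y < e / 2 / (c + 1).
  by near: y; apply: nbhs_right_lt; rewrite divr_gt0// ltr_wpDl.
have py s := ltW (poisson_gt0 s y0); have q1 s := ltW (poisson_gt0 s (@ltr01 R)).
have mpy : measurable_fun setT (fun s => (poisson y s)%:E).
  by apply/measurable_EFinP; exact: measurable_poisson.
have mp1 : measurable_fun setT (fun s : R => (poisson 1 s)%:E).
  by apply/measurable_EFinP; exact: measurable_poisson.
have := Lp_poissonU_sub_le 1 LF y0.
under eq_integral do rewrite mul1r.
move=> /le_trans; apply.
(* The sum of the near and far bounds majorizes on the whole line, so the domain need not be
   split. *)
apply: (@le_trans _ _ (\int[mu]_s ((e / 2)%:E * (poisson y s)%:E +
    (c * y)%:E * (poisson 1 s)%:E))%E).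
  apply: ge0_le_integral => //.
  - by move=> s _; apply: mule_ge0; [rewrite lee_fin|exact: om0].
  - apply: emeasurable_funM => //.
    pose f (z : measurableTypeR R * measurableTypeR R) : \bar R :=
      (`|F (z.1 + z.2) - 1 * F z.1| `^ p)%:E.
    apply: (measurable_fun_fubini_tonelli_G (m1 := mu) f).
    + apply/measurable_EFinP; apply: (measurableT_comp (measurable_powR p)).
      apply: measurableT_comp => //; apply: measurable_funB.
        by apply: (measurableT_comp mF); apply: measurable_funD.
      by apply: measurable_funM => //; exact: (measurableT_comp mF measurable_fst).
    + by move=> z; rewrite lee_fin powR_ge0.
  - by apply: emeasurable_funD; exact: measurable_funeM.
  - move=> s _; have [sr|rs] := ltP `|s| r.
      apply: (@le_trans _ _ ((poisson y s)%:E * (e / 2)%:E)%E).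
        rewrite lee_wpmul2l ?lee_fin//; apply: le_trans (Hr s sr).
        by under eq_integral do rewrite mul1r.
      rewrite muleC -!EFinM -EFinD lee_fin lerDl mulr_ge0// mulr_ge0// ltW//.
    apply: (@le_trans _ _ ((poisson y s)%:E * M%:E)%E).
      by rewrite lee_wpmul2l ?lee_fin//; exact: HM.
    rewrite -!EFinM -EFinD lee_fin.
    apply: (@le_trans _ _ (c * y * poisson 1 s)).
      have := ler_wpM2r M0 (poisson_tail_le r0 y0 rs).
      by move=> /le_trans; apply; rewrite /c le_eqVlt; apply/orP; left; apply/eqP; ring.
    by rewrite lerDr mulr_ge0// ltW.
have cy0 : 0 <= c * y by rewrite mulr_ge0// ltW.
rewrite ge0_integralD//; last 4 first.
- by move=> s _; rewrite -EFinM lee_fin mulr_ge0// ltW.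
- exact: measurable_funeM.
- by move=> s _; rewrite -EFinM lee_fin mulr_ge0.
- exact: measurable_funeM.
rewrite !ge0_integralZl_EFin//; try by move=> s _; rewrite lee_fin.
2: exact: ltW.
rewrite !integral_poisson// !mule1 -EFinD lee_fin.
have : c * y <= e / 2.
  apply: (@le_trans _ _ ((c + 1) * y)).
    by rewrite ler_wpM2r ?(ltW y0)// lerDl.
  by rewrite mulrC -ler_pdivlMr ?ltr_wpDl// ltW.
lra.
Unshelve. all: end_near. Qed.

Lemma LpnormE (G : R -> R) :
  Lpnorm p G = ((\int[mu]_x (`|G x| `^ p)%:E) `^ p^-1)%E.
Proof. by rewrite /Lpnorm unlock. Qed.

Lemma Lpnorm_mono (G H : R -> R) :
  (\int[mu]_x (`|G x| `^ p)%:E <= \int[mu]_x (`|H x| `^ p)%:E)%E ->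
  (Lpnorm p G <= Lpnorm p H)%E.
Proof.
move=> GH; rewrite !LpnormE; apply: gt0_ler_poweR => //.
- by rewrite invr_ge0 ltW.
- by rewrite in_itv/= leey andbT; apply: integral_ge0 => x _; rewrite lee_fin powR_ge0.
- by rewrite in_itv/= leey andbT; apply: integral_ge0 => x _; rewrite lee_fin powR_ge0.
Qed.

Lemma Lpnorm_le (G : R -> R) (e : R) : 0 <= e ->
  (\int[mu]_x (`|G x| `^ p)%:E <= (e `^ p)%:E)%E -> (Lpnorm p G <= e%:E)%E.
Proof.
move=> e0 Ge; rewrite LpnormE.
rewrite (_ : e%:E = ((e `^ p)%:E `^ p^-1)%E).
  apply: gt0_ler_poweR => //.
  - by rewrite invr_ge0 ltW.
  - by rewrite in_itv/= leey andbT; apply: integral_ge0 => x _; rewrite lee_fin powR_ge0.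
  - by rewrite in_itv/= leey andbT lee_fin powR_ge0.
by rewrite poweR_EFin -powRrM divff ?powRr1// gt_eqF.
Qed.

Lemma Lpnorm_poissonU_cvg F : inLp p F ->
  Lpnorm p (fun x => poissonU F y x - F x) @[y --> 0^'+] --> 0%E.
Proof.
move=> LF.
have H (e : R) : 0 < e ->
    \forall y \near 0^'+, (Lpnorm p (fun x => poissonU F y x - F x)%R <= e%:E)%E.
  move=> e0; have := Lp_poissonU_cvg LF (powR_gt0 p e0).
  by apply: filterS => y; apply: Lpnorm_le; exact: ltW.
have L0 (G : R -> R) : (0 <= Lpnorm p G)%E by exact: Lnorm_ge0.
apply/fine_cvgP; split.
  (* Convergence to a finite limit includes finiteness near $0$, which the bound with $e=1$
     provides. *)
  have := H 1 ltr01; apply: filterS => y Hy.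
  by rewrite ge0_fin_numE// (le_lt_trans Hy)// ltry.
apply/cvgr0Pnorm_le => e e0; have := H e e0; apply: filterS => y Hy /=.
rewrite ger0_norm ?fine_ge0// -lee_fin fineK//.
by rewrite ge0_fin_numE// (le_lt_trans Hy)// ltry.
Qed.

End Lp_poisson.

Theorem mainTheorem18 (R : realType) (p : R) (n : nat) (F : R -> R) :
  1 <= p -> inLp p F ->
  (* (a) *)
  (forall x y : R, 0 < y ->
     (@lebesgue_measure R).-integrable setT (EFin \o poisson_integrand n F y x) /\
     (forall k : nat, (k < n)%N -> forall t : R,
        derivable (derive1n k (poissonU F y)) t 1) /\
     poissonu n F y x = derive1n n (poissonU F y) x) /\
  (* (b) *)
  harmonic_on (@upper_half_plane R) (fun z => poissonu n F z.2 z.1) /\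
  (* (c) *)
  (forall y : R, 0 < y ->
     inLp p (poissonU F y) /\
     is_nth_distr_deriv n (poissonu n F y) (poissonU F y) /\
     (Lpnorm p (poissonU F y) <= Lpnorm p F)%E) /\
  (* (d) *)
  (Lpnorm p (fun x => poissonU F y x - F x) @[y --> 0^'+] --> 0%E).
Proof.
move=> p1 LF; have wF := inLp_weighted_integrable p1 LF.
split; [|split; [|split]].
- move=> x y y0; split; first exact: integrable_poisson_integrand.
  split; last by rewrite poissonuE// derive1n_poissonU.
  by move=> k _ t; exact: derivable_derive1n_poissonU.
- apply: (harmonic_cint (c := - pi^-1 * n`!%:R) wF (ltn0Sn n)) => z z0.
  exact: poissonuE.
- move=> y y0; have le_F := Lp_poissonU_le p1 LF y0.
  split; [split|split].
  + by apply: continuous_measurable_fun; exact: continuous_poissonU.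
  + by apply: le_lt_trans le_F _; case: LF.
  + rewrite (_ : poissonu n F y = derive1n n (poissonU F y)); last first.
      by apply/funext => x; rewrite poissonuE// derive1n_poissonU.
    apply: is_nth_distr_deriv_derive1n.
      by move=> k x; exact: derivable_derive1n_poissonU.
    (* The range of heights is reduced to the single value [y]. *)
    move=> k; have [C C0 HC] := cint_bound y wF (ltn0Sn k : (false < k.+1)%N) y0.
    exists (`|- pi^-1 * k`!%:R| * C); first exact: mulr_ge0.
    move=> x; rewrite derive1n_poissonU// normrM -mulrA ler_wpM2l//.
    by apply: HC; rewrite lexx.
  + exact: Lpnorm_mono.
- exact: Lpnorm_poissonU_cvg.
Qed.
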